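(* Let $\mathcal E$ be a model category, $\mathcal J$ a weak lattice, $\widetilde Y:\mathcal J\to\operatorname{ho}(\mathcal E)$ a functor, and $x\in\operatorname{Obj}\mathcal J$ with $|x|>n\ge k\ge 2$. Let $\widetilde Y^x_k:\mathcal J^x_k\to\operatorname{ho}(\mathcal E)$ be the restriction of $\widetilde Y$, let $Y_k:\partial\mathcal J^x_k\to\mathcal E$ be a Reedy fibrant functor lifting $\widetilde Y^x_k|_{\partial\mathcal J^x_k}$, and let $Y^x_{k-1}:\mathcal J^x_{k-1}\to\mathcal E$ be a functor lifting $\widetilde Y^x_k|_{\mathcal J^x_{k-1}}$ which agrees with $Y_k$ on $\partial\mathcal J^x_{k-1}$. Then the total higher homotopy operation $\langle Y^x_{k-1}\rangle$ separates into a sequence of $k-1$ obstructions $\langle Y^x_{k-1}\rangle^{j+1}$ ($1\le j<k$), and the following are equivalent: (1) there is a functor $Y^x_k:\mathcal J^x_k\to\mathcal E$ lifting $\widetilde Y^x_k$ and strictly extending $Y_k$ and $Y^x_{k-1}$; (2) the total operation $\langle Y^x_{k-1}\rangle$ vanishes; (3) the associated sequence $\langle Y^x_{k-1}\rangle^{j+1}$ ($1\le j<k$) of separated higher homotopy operations vanishes (so in particular each in turn is defined).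
   Context: **Weak lattices.** A weak lattice is a connected Reedy indexing category $\mathcal J$ with finite Hom-sets and a degree function $|\cdot|:\operatorname{Obj}\mathcal J\to\mathbb N$ such that there are finitely many objects in each degree, all non-identity morphisms strictly decrease degree, and every object maps to at least one object of degree $0$. For $x\in\operatorname{Obj}\mathcal J$, $\mathcal J^x$ is the full subcategory on the objects $t$ with $\mathcal J(x,t)\ne\emptyset$. For $k<|x|$, $\mathcal J^x_k$ is the full subcategory of $\mathcal J^x$ on $x$ and all its objects of degree $\le k$, and $\partial\mathcal J^x_k$ is its full subcategory on all objects other than $x$. **Matching objects.** For a functor $Y$ defined on $\partial\mathcal J^x_k$, $\mathbf M^x_k$ is the limit of $(f:x\to s)\mapsto Y(s)$ over the category of morphisms in $\mathcal J$ from $x$ to objects of degree $\le k$ (morphisms: commuting triangles under $x$); $\operatorname{forget}:\mathbf M^x_k\to\prod_{|t|\le k}\prod_{\mathcal J(x,t)}Y(t)$ is the inclusion. If $Y$ is defined on $\mathcal J^x_k$, $\operatorname m^x_k:Y(x)\to\mathbf M^x_k$ is the canonical map. $Y$ is Reedy fibrant if each $\operatorname m^s_{|s|-1}:Y(s)\to\mathbf M^s_{|s|-1}$ is a fibration (for $|s|=0$: $Y(s)$ is fibrant). **Conventions.** A functor into $\mathcal E$ lifts a functor into $\operatorname{ho}(\mathcal E)$ if it has the given composite with $\mathcal E\to\operatorname{ho}(\mathcal E)$. All objects $\widetilde Y(s)$ are fibrant and cofibrant; in particular $Y(x):=Y^x_{k-1}(x)$ is cofibrant; $\sim$ denotes homotopy.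 $Y(t)$ denotes the common value of the given functors. **Notation for an object $y$** with $|y|>m\ge2$ ($y=x$ and $m=k$, or $y\in\partial\mathcal J^x_k$). Put $A^y_m=\prod_{|v|=m}\prod_{\mathcal J(y,v)}Y(v)$, $B^y_m=\prod_{|t|<m}\prod_{\mathcal J(y,t)}Y(t)$, $D^y_m=\prod_{|v|=m}\prod_{\mathcal J(y,v)}\prod_{|u|<m}\prod_{\mathcal J(v,u)}Y(u)$, $L^y_m=\prod_{|v|=m}\prod_{\mathcal J(y,v)}\mathbf M^v_{m-1}$. The generalized diagonal $\Psi:B^y_m\to D^y_m$ has component at $(g:y\to v,f:v\to u)$ the projection to the factor indexed by $f\circ g$. There are maps $A^y_m\to L^y_m$ (product of the $\operatorname m^v_{m-1}$) and $L^y_m\to D^y_m$ (product of forgetful maps). Put $$\mathbf Q^y_{m-1}=B^y_m\times_{D^y_m}L^y_m,\qquad \mathbf N^y_{m-1}=\mathbf M^y_{m-1}\times_{B^y_m}\mathbf Q^y_{m-1},\qquad \mathbf P^y_m=\mathbf Q^y_{m-1}\times_{L^y_m}A^y_m,$$ so that $\mathbf M^y_m\cong\mathbf N^y_{m-1}\times_{\mathbf Q^y_{m-1}}\mathbf P^y_m$. **Separation grid $F^{\bullet,\bullet}_{y,m}$ (recursive in $m\ge2$).** *Column $0$:* $F^{0,m+1}_{y,m}=A^y_m$, $F^{0,m}_{y,m}=L^y_m$, $F^{0,1}_{y,m}=D^y_m$, and for $1\le j\le m-2$, $F^{0,j+1}_{y,m}=\prod_{|v|=m}\prod_{\mathcal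 J(y,v)}\big(F^{j,m}_{v,m-1}\times G^{j,m}_{v,m-1}\big)$. The vertical maps $F^{0,i+1}\to F^{0,i}$ are: the map $A^y_m\to L^y_m$ given by the product of the maps $\operatorname m^v_{m-1}:Y(v)\to\mathbf M^v_{m-1}$; (for $m=2$) the map $L^y_m\to D^y_m$ given by the product of the forgetful maps $\operatorname{forget}:\mathbf M^v_{m-1}\to\prod_{|u|<m}\prod_{\mathcal J(v,u)}Y(u)$; (for $m>2$) the product of the maps $\mathbf M^v_{m-1}\to F^{m-2,m}_{v,m-1}\times G^{m-2,m}_{v,m-1}$ given by $\mathbf M^v_{m-1}\to\mathbf P^v_{m-1}\to F^{m-2,m}_{v,m-1}$ and $\mathbf M^v_{m-1}\to\mathbf N^v_{m-2}\to G^{m-2,m}_{v,m-1}$; and below that the products of the horizontal fibrations $F^{j,m}_{v,m-1}\to F^{j-1,m}_{v,m-1}$ and of the fibrations $G^{j,m}_{v,m-1}\to G^{j-1,m}_{v,m-1}$. *The objects $G^{j,m+1}_{y,m}$ ($0\le j\le m-1$):* $G^{j,m+1}_{y,m}=B^y_m\times_{D^y_m}F^{0,j+1}_{y,m}$ (pullback along $\Psi$) for $0\le j\le m-2$ (so $G^{0,m+1}_{y,m}=B^y_m$), while $G^{m-1,m+1}_{y,m}$ is obtained by factoring $\mathbf N^y_{m-1}\to\mathbf Q^y_{m-1}\to G^{m-2,m+1}_{y,m}$ as an acyclic cofibration $\mathbf N^y_{m-1}\to G^{m-1,m+1}_{y,m}$ followed by a fibration. *Column $1$:* factor $\Psi:B^y_m\to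 D^y_m$ as an acyclic cofibration $\iota:B^y_m\to F^{1,1}_{y,m}$ followed by a fibration $q_1:F^{1,1}_{y,m}\to F^{0,1}_{y,m}$; put $F^{1,i}_{y,m}=F^{1,1}_{y,m}\times_{F^{0,1}_{y,m}}F^{0,i}_{y,m}$ for $2\le i\le m+1$, and let $\varphi^1:\mathbf Q^y_{m-1}\to B^y_m\xrightarrow{\iota}F^{1,1}_{y,m}$. *Column $j+1$ ($1\le j\le m-2$):* factor the induced map $\mathbf Q^y_{m-1}\to F^{j,j+1}_{y,m}$ as an acyclic cofibration $\varphi^{j+1}:\mathbf Q^y_{m-1}\to F^{j+1,j+1}_{y,m}$ followed by a fibration $q_{j+1}$; put $F^{j+1,i}_{y,m}=F^{j+1,j+1}_{y,m}\times_{F^{j,j+1}_{y,m}}F^{j,i}_{y,m}$ for $j+2\le i\le m+1$. The maps $\varphi^j$ and $\mathbf Q^y_{m-1}\to L^y_m$ induce compatible maps from $\mathbf Q^y_{m-1}$ to all $F^{j,i}_{y,m}$ with $i\le m$, and there is an induced map $\mathbf P^y_m\to F^{m-1,m+1}_{y,m}$. **Maps in the grid for $(x,k)$.** Write $F^{j,i}=F^{j,i}_{x,k}$; $\gamma_k:\mathbf Q^x_{k-1}\to F^{k-1,k}$ and $\Gamma_{k-1}:\mathbf Q^x_{k-1}\to F^{1,k}$ are the induced maps; $\varphi^k=\mathrm{Id}_{\mathbf Q^x_{k-1}}$, $q_k=\gamma_k$. Further $u_j:F^{j,k+1}\to F^{j-1,k+1}$, $p_j:F^{j,j+1}\to F^{j-1,j+1}$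 are horizontal maps, and $r_j:F^{j,j+1}\to F^{j,j}$, $\Phi^j:F^{j,k+1}\to F^{j,j+1}$, $\beta_j:F^{j,k+1}\to F^{j,j+2}$ are vertical (composite) maps. **Maps out of $Y(x)$.** $\sigma^x_{<k}:Y(x)\to B^x_k$ has components $Y^x_{k-1}(f)$. $\sigma^x_k:Y(x)\to A^x_k$ is a fixed map whose component at $g$ represents $\widetilde Y^x_k(g)$. $\eta_{k-1}:Y(x)\to\mathbf Q^x_{k-1}$ is induced by $\sigma^x_{<k}$ and by the maps $Y(x)\to\mathbf M^s_{k-1}$ (for $g:x\to s$, $|s|=k$) with component $Y^x_{k-1}(f\circ g)$ at $f:s\to v$. **Total operation.** $\langle Y^x_{k-1}\rangle$ is the set of homotopy classes of maps $\theta:Y(x)\to F^{1,k}$ whose composite $\varphi$ with $F^{1,k}\to F^{1,1}$ satisfies $\varphi\sim\iota\circ\sigma^x_{<k}$ and $q_1\circ\varphi=$ the composite $Y(x)\xrightarrow{\sigma^x_k}A^x_k\to D^x_k$. It vanishes if it contains $[\Gamma_{k-1}\circ\eta_{k-1}]$. **Separated operations.** Put $\kappa_0=\sigma^x_k$. For $1\le j<k$, given $\kappa_{j-1}:Y(x)\to F^{j-1,k+1}$, the separated operation $\langle Y^x_{k-1}\rangle^{j+1}$ of order $j+1$ is the set of homotopy classes of maps $\theta:Y(x)\to F^{j,j+1}$ with $r_j\circ\theta\sim\varphi^j\circ\eta_{k-1}$ and $p_j\circ\theta=\beta_{j-1}\circ\kappa_{j-1}$. It vanishes at such a $\theta$ if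 $\theta\sim q_{j+1}\circ\varphi^{j+1}\circ\eta_{k-1}$. The pair $(\kappa_{j-1},\theta)$ determines a unique $\kappa_j:Y(x)\to F^{j,k+1}$ with $u_j\circ\kappa_j=\kappa_{j-1}$ and $\Phi^j\circ\kappa_j=\theta$; when the operation of order $j+1$ vanishes at $\theta$, the operation of order $j+2$ is defined using this $\kappa_j$. The sequence vanishes if maps $\theta$ can be chosen successively for $j=1,\dots,k-1$ so that each operation in turn is defined and vanishes at the chosen $\theta$. *)

(* Defs.v *)
From Stdlib Require Import Relations FinFun.
From Stdlib Require Import FunctionalExtensionality PropExtensionality.
From Stdlib Require Import ProofIrrelevance ClassicalEpsilon.
From mathcomp Require Import ssreflect ssrfun ssrbool eqtype ssrnat.

Set Implicit Arguments.
Unset Strict Implicit.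
Unset Printing Implicit Defensive.

Record category := Category {
  ob :> Type;
  hom : ob -> ob -> Type;
  idm : forall X, hom X X;
  comp : forall X Y Z, hom Y Z -> hom X Y -> hom X Z;
  comp1m : forall X Y (f : hom X Y), comp (idm Y) f = f;
  compm1 : forall X Y (f : hom X Y), comp f (idm X) = f;
  compA : forall W X Y Z (h : hom Y Z) (g : hom X Y) (f : hom W X),
    comp h (comp g f) = comp (comp h g) f
}.
Arguments hom {c} X Y.
Arguments idm {c} X.
Arguments comp {c X Y Z} g f.
Notation "g ∘ f" := (comp g f) (at level 40, left associativity).

Definition op (C : category) : category :=
  @Category C (fun X Y => @hom C Y X) (@idm C) (fun X Y Z g f => f ∘ g)
    (fun X Y f => compm1 f) (fun X Y f => comp1m f)
    (fun W X Y Z h g f => esym (compA f g h)).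

Record functor (C D : category) := Functor {
  fob :> C -> D;
  fmap : forall X Y : C, hom X Y -> hom (fob X) (fob Y);
  fmap1 : forall X : C, fmap (idm X) = idm (fob X);
  fmapM : forall (X Y Z : C) (g : hom Y Z) (f : hom X Y),
    fmap (g ∘ f) = fmap g ∘ fmap f
}.

Definition is_limit (K C : category) (D : functor K C) (L : C)
    (pr : forall i : K, hom L (D i)) : Prop :=
  (forall (i j : K) (f : hom i j), fmap D f ∘ pr i = pr j) /\
  (forall (Z : C) (t : forall i : K, hom Z (D i)),
     (forall (i j : K) (f : hom i j), fmap D f ∘ t i = t j) ->
     exists! u : hom Z L, forall i, pr i ∘ u = t i).

Definition has_finite_limits (C : category) : Prop :=
  forall K : category, Finite K -> (forall i j : K, Finite (hom i j)) ->
  forall D : functor K C,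
  exists (L : C) (pr : forall i : K, hom L (D i)), is_limit pr.

Definition is_terminal (C : category) (T : C) : Prop :=
  forall X : C, exists! f : hom X T, True.

Definition connected (C : category) : Prop :=
  inhabited C /\
  forall X Y : C, clos_refl_sym_trans C (fun A B => inhabited (hom A B)) X Y.

Inductive is_identity (C : category) : forall X Y : C, hom X Y -> Prop :=
| IsIdentity X : is_identity (idm X).

(** Chosen products and pullbacks, with their universal property given by an
    operation producing the induced map. *)

Record product (C : category) (I : Type) (X : I -> C) := Product {
  prod_ob :> C;
  proj : forall i, hom prod_ob (X i);
  tuple : forall Z : C, (forall i, hom Z (X i)) -> hom Z prod_ob;
  proj_tuple : forall (Z : C) (t : forall i, hom Z (X i)) i,
    proj i ∘ tuple t = t i;
  prod_ext : forall (Z : C) (u v : hom Z prod_ob),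
    (forall i, proj i ∘ u = proj i ∘ v) -> u = v
}.
Arguments proj {C I X} p i.
Arguments tuple {C I X} p {Z} t.
Arguments proj_tuple {C I X} p {Z} t i : rename.
Arguments prod_ext {C I X} p {Z u v} _ : rename.

Definition prod_map (C : category) (I : Type) (X Y : I -> C)
    (p : product X) (q : product Y) (f : forall i, hom (X i) (Y i)) : hom p q :=
  tuple q (fun i => f i ∘ proj p i).

Record binary_product (C : category) (X Y : C) := BinaryProduct {
  bp_ob :> C;
  bfst : hom bp_ob X;
  bsnd : hom bp_ob Y;
  bpair : forall Z : C, hom Z X -> hom Z Y -> hom Z bp_ob;
  bfst_pair : forall (Z : C) (f : hom Z X) (g : hom Z Y), bfst ∘ bpair f g = f;
  bsnd_pair : forall (Z : C) (f : hom Z X) (g : hom Z Y), bsnd ∘ bpair f g = g;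
  bp_ext : forall (Z : C) (u v : hom Z bp_ob),
    bfst ∘ u = bfst ∘ v -> bsnd ∘ u = bsnd ∘ v -> u = v
}.
Arguments bfst {C X Y} b.
Arguments bsnd {C X Y} b.
Arguments bpair {C X Y} b {Z} f g.

Record pullback (C : category) (X Y Z : C) (f : hom X Z) (g : hom Y Z) :=
  Pullback {
  pb_ob :> C;
  pb1 : hom pb_ob X;
  pb2 : hom pb_ob Y;
  pb_square : f ∘ pb1 = g ∘ pb2;
  pb_pair : forall (W : C) (a : hom W X) (b : hom W Y),
    f ∘ a = g ∘ b -> hom W pb_ob;
  pb1_pair : forall (W : C) (a : hom W X) (b : hom W Y) (e : f ∘ a = g ∘ b),
    pb1 ∘ pb_pair e = a;
  pb2_pair : forall (W : C) (a : hom W X) (b : hom W Y) (e : f ∘ a = g ∘ b),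
    pb2 ∘ pb_pair e = b;
  pb_ext : forall (W : C) (u v : hom W pb_ob),
    pb1 ∘ u = pb1 ∘ v -> pb2 ∘ u = pb2 ∘ v -> u = v
}.
Arguments pb1 {C X Y Z f g} p.
Arguments pb2 {C X Y Z f g} p.
Arguments pb_pair {C X Y Z f g} p {W a b} e.
Arguments pb1_pair {C X Y Z f g} p {W a b} e : rename.
Arguments pb2_pair {C X Y Z f g} p {W a b} e : rename.
Arguments pb_ext {C X Y Z f g} p {W u v} _ _ : rename.

Definition has_lifting (C : category) (A B X Y : C)
    (i : hom A B) (p : hom X Y) : Prop :=
  forall (f : hom A X) (g : hom B Y), p ∘ f = g ∘ i ->
  exists h : hom B X, h ∘ i = f /\ p ∘ h = g.

Definition is_retract (C : category) (A B X Y : C)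
    (f : hom A B) (g : hom X Y) : Prop :=
  exists (i : hom A X) (r : hom X A) (i' : hom B Y) (r' : hom Y B),
    [/\ r ∘ i = idm A, r' ∘ i' = idm B, g ∘ i = i' ∘ f & f ∘ r = r' ∘ g].

(** Quillen's (closed) model categories: only finite limits and colimits are
    required, and factorizations need not be functorial. *)
Record model_category := ModelCategory {
  mc_cat :> category;
  weq : forall X Y : mc_cat, hom X Y -> Prop;
  fib : forall X Y : mc_cat, hom X Y -> Prop;
  cof : forall X Y : mc_cat, hom X Y -> Prop;
  mc_lim : has_finite_limits mc_cat;
  mc_colim : has_finite_limits (op mc_cat);
  weq_id : forall X, weq (idm X);
  fib_id : forall X, fib (idm X);
  cof_id : forall X, cof (idm X);
  fib_comp : forall X Y Z (g : hom Y Z) (f : hom X Y),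
    fib g -> fib f -> fib (g ∘ f);
  cof_comp : forall X Y Z (g : hom Y Z) (f : hom X Y),
    cof g -> cof f -> cof (g ∘ f);
  weq_comp : forall X Y Z (g : hom Y Z) (f : hom X Y),
    weq g -> weq f -> weq (g ∘ f);
  weq_cancell : forall X Y Z (g : hom Y Z) (f : hom X Y),
    weq g -> weq (g ∘ f) -> weq f;
  weq_cancelr : forall X Y Z (g : hom Y Z) (f : hom X Y),
    weq f -> weq (g ∘ f) -> weq g;
  weq_retract : forall A B X Y (f : @hom mc_cat A B) (g : @hom mc_cat X Y),
    is_retract f g -> weq g -> weq f;
  fib_retract : forall A B X Y (f : @hom mc_cat A B) (g : @hom mc_cat X Y),
    is_retract f g -> fib g -> fib f;
  cof_retract : forall A B X Y (f : @hom mc_cat A B) (g : @hom mc_cat X Y),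
    is_retract f g -> cof g -> cof f;
  cof_lift_acyclic_fib : forall A B X Y
      (i : @hom mc_cat A B) (p : @hom mc_cat X Y),
    cof i -> fib p -> weq p -> has_lifting i p;
  acyclic_cof_lift_fib : forall A B X Y
      (i : @hom mc_cat A B) (p : @hom mc_cat X Y),
    cof i -> weq i -> fib p -> has_lifting i p;
  factor_cof_acyclic_fib : forall X Y (f : @hom mc_cat X Y),
    exists Z (i : hom X Z) (p : hom Z Y), [/\ p ∘ i = f, cof i, fib p & weq p];
  factor_acyclic_cof_fib : forall X Y (f : @hom mc_cat X Y),
    exists Z (i : hom X Z) (p : hom Z Y), [/\ p ∘ i = f, cof i, weq i & fib p]
}.
Arguments weq {m X Y} f.
Arguments fib {m X Y} f.
Arguments cof {m X Y} f.

Record acf_factorization (E : model_category) (X Y : E) (f : hom X Y) :=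
  AcfFactorization {
  acf_mid : E;
  acf_cof : hom X acf_mid;
  acf_fib : hom acf_mid Y;
  acf_eq : acf_fib ∘ acf_cof = f;
  acf_cof_cof : cof acf_cof;
  acf_cof_weq : weq acf_cof;
  acf_fib_fib : fib acf_fib
}.

Section Homotopy.
Variable E : model_category.

Definition fibrant (X : E) : Prop :=
  forall T : E, is_terminal T -> forall f : hom X T, fib f.

Definition cofibrant (X : E) : Prop :=
  forall I : E, @is_terminal (op E) I -> forall f : hom I X, cof f.

Definition left_homotopic (X Y : E) (f g : hom X Y) : Prop :=
  exists (C : E) (i0 i1 : hom X C) (s : hom C X) (H : hom C Y),
    [/\ weq s, s ∘ i0 = idm X, s ∘ i1 = idm X, H ∘ i0 = f & H ∘ i1 = g].

Definition right_homotopic (X Y : E) (f g : hom X Y) : Prop :=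
  exists (P : E) (p0 p1 : hom P Y) (s : hom Y P) (H : hom X P),
    [/\ weq s, p0 ∘ s = idm Y, p1 ∘ s = idm Y, p0 ∘ H = f & p1 ∘ H = g].

Definition homotopic (X Y : E) (f g : hom X Y) : Prop :=
  left_homotopic f g /\ right_homotopic f g.

(** A set of maps [X -> Y]; the class of [f] is an equivalence class as soon
    as [X] is cofibrant and [Y] is fibrant. *)
Definition homotopy_class (X Y : E) (f : hom X Y) : hom X Y -> Prop :=
  homotopic f.

(** The homotopy category [ho E] below is the localization of [E] at its weak
    equivalences, with the same objects as [E].  Its maps are zigzags modulo
    the congruence generated by the category laws of [E] and the inversion of
    the weak equivalences. *)

Inductive zigzag (X : E) : E -> Type :=
| zz_nil : zigzag X X
| zz_fwd Y Z : zigzag X Y -> hom Y Z -> zigzag X Z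
| zz_bwd Y Z (w : hom Z Y) : weq w -> zigzag X Y -> zigzag X Z.

Inductive zz_eq (X : E) : forall Y : E, zigzag X Y -> zigzag X Y -> Prop :=
| zz_refl Y (p : zigzag X Y) : zz_eq p p
| zz_sym Y (p q : zigzag X Y) : zz_eq p q -> zz_eq q p
| zz_trans Y (p q r : zigzag X Y) : zz_eq p q -> zz_eq q r -> zz_eq p r
| zz_cong_fwd Y Z (p q : zigzag X Y) (f : hom Y Z) :
    zz_eq p q -> zz_eq (zz_fwd p f) (zz_fwd q f)
| zz_cong_bwd Y Z (p q : zigzag X Y) (w : hom Z Y) (hw : weq w) :
    zz_eq p q -> zz_eq (zz_bwd hw p) (zz_bwd hw q)
| zz_fwd_id Y (p : zigzag X Y) : zz_eq (zz_fwd p (idm Y)) p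
| zz_fwd_comp Y Z W (p : zigzag X Y) (f : hom Y Z) (g : hom Z W) :
    zz_eq (zz_fwd (zz_fwd p f) g) (zz_fwd p (g ∘ f))
| zz_bwd_fwd Y Z (p : zigzag X Y) (w : hom Z Y) (hw : weq w) :
    zz_eq (zz_fwd (zz_bwd hw p) w) p
| zz_fwd_bwd Y Z (p : zigzag X Z) (w : hom Z Y) (hw : weq w) :
    zz_eq (zz_bwd hw (zz_fwd p w)) p.

Fixpoint zz_cat (X Y Z : E) (p : zigzag X Y) (q : zigzag Y Z) : zigzag X Z :=
  match q in zigzag _ W return zigzag X W with
  | zz_nil => p
  | zz_fwd _ _ q' f => zz_fwd (zz_cat p q') f
  | zz_bwd _ _ _ hw q' => zz_bwd hw (zz_cat p q')
  end.

Lemma zz_cat_eql (X Y Z : E) (p p' : zigzag X Y) (q : zigzag Y Z) :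
  zz_eq p p' -> zz_eq (zz_cat p q) (zz_cat p' q).
Proof.
move=> h; elim: q => [|U V q IH f|U V w hw q IH] //=.
- exact: zz_cong_fwd.
- exact: zz_cong_bwd.
Qed.

Lemma zz_cat_eqr (X Y Z : E) (p : zigzag X Y) (q q' : zigzag Y Z) :
  zz_eq q q' -> zz_eq (zz_cat p q) (zz_cat p q').
Proof.
elim=> /=.
- by move=> *; exact: zz_refl.
- by move=> *; exact: zz_sym.
- by move=> U a b c _ h1 _ h2; exact: zz_trans h1 h2.
- by move=> *; exact: zz_cong_fwd.
- by move=> *; exact: zz_cong_bwd.
- by move=> *; exact: zz_fwd_id.
- by move=> *; exact: zz_fwd_comp.
- by move=> *; exact: zz_bwd_fwd.
- by move=> *; exact: zz_fwd_bwd.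
Qed.

Lemma zz_cat_nill (X Y : E) (p : zigzag X Y) : zz_cat (zz_nil X) p = p.
Proof. by elim: p => [|U V q IH f|U V w hw q IH] //=; rewrite IH. Qed.

Lemma zz_catA (W X Y Z : E) (p : zigzag W X) (q : zigzag X Y)
    (r : zigzag Y Z) : zz_cat p (zz_cat q r) = zz_cat (zz_cat p q) r.
Proof. by elim: r => [|U V r IH f|U V w hw r IH] //=; rewrite IH. Qed.

Definition ho_hom (X Y : E) : Type :=
  {c : zigzag X Y -> Prop | exists p, c = @zz_eq X Y p}.

Definition zz_class (X Y : E) (p : zigzag X Y) : ho_hom X Y :=
  exist _ (@zz_eq X Y p) (ex_intro _ p erefl).

Definition zz_repr (X Y : E) (c : ho_hom X Y) : zigzag X Y :=
  proj1_sig (constructive_indefinite_description _ (proj2_sig c)).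

Lemma zz_classP (X Y : E) (p q : zigzag X Y) :
  zz_class p = zz_class q <-> zz_eq p q.
Proof.
split=> [[e]|h].
  by rewrite e; exact: zz_refl.
apply: subset_eq_compat; apply: functional_extensionality => r.
apply: propositional_extensionality; split=> hr.
- exact: zz_trans (zz_sym h) hr.
- exact: zz_trans h hr.
Qed.

Lemma zz_reprK (X Y : E) (c : ho_hom X Y) : zz_class (zz_repr c) = c.
Proof.
rewrite /zz_repr; case: constructive_indefinite_description => p /= e.
by case: c e => c hc /= e; apply: subset_eq_compat.
Qed.

Definition ho_comp (X Y Z : E) (d : ho_hom Y Z) (c : ho_hom X Y) : ho_hom X Z :=
  zz_class (zz_cat (zz_repr c) (zz_repr d)).

Lemma zz_repr_class (X Y : E) (p : zigzag X Y) : zz_eq (zz_repr (zz_class p)) p.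
Proof. by apply/zz_classP; rewrite zz_reprK. Qed.

Lemma ho_comp_class (X Y Z : E) (p : zigzag X Y) (q : zigzag Y Z) :
  ho_comp (zz_class q) (zz_class p) = zz_class (zz_cat p q).
Proof.
apply/zz_classP; apply: zz_trans (zz_cat_eql _ (zz_repr_class p)) _.
exact: zz_cat_eqr (zz_repr_class q).
Qed.

Lemma ho_comp1m (X Y : E) (c : ho_hom X Y) : ho_comp (zz_class (zz_nil Y)) c = c.
Proof. by rewrite -(zz_reprK c) ho_comp_class. Qed.

Lemma ho_compm1 (X Y : E) (c : ho_hom X Y) : ho_comp c (zz_class (zz_nil X)) = c.
Proof. by rewrite -(zz_reprK c) ho_comp_class zz_cat_nill. Qed.

Lemma ho_compA (W X Y Z : E) (e : ho_hom Y Z) (d : ho_hom X Y)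
    (c : ho_hom W X) : ho_comp e (ho_comp d c) = ho_comp (ho_comp e d) c.
Proof.
rewrite -(zz_reprK c) -(zz_reprK d) -(zz_reprK e) !ho_comp_class.
by rewrite zz_catA.
Qed.

Definition ho : category :=
  @Category E ho_hom (fun X => zz_class (zz_nil X)) ho_comp
    ho_comp1m ho_compm1 ho_compA.

Definition gamma_map (X Y : E) (f : hom X Y) : @hom ho X Y :=
  zz_class (zz_fwd (zz_nil X) f).

Lemma gamma_id (X : E) : gamma_map (idm X) = @idm ho X.
Proof. by apply/zz_classP; exact: zz_fwd_id. Qed.

Lemma gamma_comp (X Y Z : E) (g : hom Y Z) (f : hom X Y) :
  gamma_map (g ∘ f) = @comp ho _ _ _ (gamma_map g) (gamma_map f).
Proof.
rewrite /= /gamma_map ho_comp_class; apply/zz_classP.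
exact: zz_sym (zz_fwd_comp _ _ _).
Qed.

Definition gamma : functor E ho :=
  @Functor E ho (fun X => X) gamma_map gamma_id gamma_comp.

End Homotopy.

Record is_reedy (J : category) (deg : J -> nat)
    (direct inverse : forall s t : J, hom s t -> Prop) : Prop := IsReedy {
  direct_id : forall s : J, direct s s (idm s);
  direct_comp : forall (r s t : J) (g : hom s t) (f : hom r s),
    direct s t g -> direct r s f -> direct r t (g ∘ f);
  direct_deg : forall (s t : J) (f : hom s t),
    direct s t f -> is_identity f \/ deg s < deg t;
  inverse_id : forall s : J, inverse s s (idm s);
  inverse_comp : forall (r s t : J) (g : hom s t) (f : hom r s),
    inverse s t g -> inverse r s f -> inverse r t (g ∘ f);
  inverse_deg : forall (s t : J) (f : hom s t),
    inverse s t f -> is_identity f \/ deg t < deg s;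
  reedy_factor : forall (s t : J) (f : hom s t),
    exists! c : {r : J & (hom s r * hom r t)%type},
      [/\ inverse s (projT1 c) (projT2 c).1, direct (projT1 c) t (projT2 c).2
        & (projT2 c).2 ∘ (projT2 c).1 = f]
}.

Record weak_lattice := WeakLattice {
  wl_cat :> category;
  deg : wl_cat -> nat;
  wl_reedy : exists direct inverse, @is_reedy wl_cat deg direct inverse;
  wl_connected : connected wl_cat;
  wl_hom_finite : forall s t : wl_cat, Finite (hom s t);
  wl_deg_finite : forall n : nat, Finite {s : wl_cat | deg s = n};
  wl_decreasing : forall (s t : wl_cat) (f : hom s t),
    is_identity f \/ deg t < deg s;
  wl_bottom : forall s : wl_cat, exists2 t : wl_cat,
    inhabited (hom s t) & deg t = 0
}.
Arguments deg {w} s.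

(** Objects of the full subcategories J^x_k and ∂J^x_k of J. *)
Definition under (J : weak_lattice) (x : J) (k : nat) (t : J) : Prop :=
  inhabited (hom x t) /\ (t = x \/ deg t <= k).

Definition boundary (J : weak_lattice) (x : J) (k : nat) (t : J) : Prop :=
  under x k t /\ t <> x.

Section Lifts.
Variables (E : model_category) (J : weak_lattice) (Yt : functor J (ho E)).

(** The objects of [ho E] are those of [E]. *)
Definition obj (s : J) : E := Yt s.

(** A functor to [E], defined on the full subcategory of [J] with objects
    [P], whose composite with [gamma] is the restriction of [Yt].  As [gamma]
    is the identity on objects, the values on objects are prescribed, and only
    the values on maps remain to be given. *)
Record lift (P : J -> Prop) := Lift {
  lmap : forall s t : J, P s -> P t -> hom s t -> hom (obj s) (obj t);
  lmap_id : forall (s : J) (p q : P s), lmap p q (idm s) = idm (obj s);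
  lmap_comp : forall (r s t : J) (p : P r) (q : P s) (u : P t)
      (g : hom s t) (f : hom r s),
    lmap p u (g ∘ f) = lmap q u g ∘ lmap p q f;
  lmap_lifts : forall (s t : J) (p : P s) (q : P t) (f : hom s t),
    gamma_map (lmap p q f) = fmap Yt f
}.

(** The two functors coincide on the full subcategory of their common
    objects. *)
Definition agree (P P' : J -> Prop) (Z : lift P) (Z' : lift P') : Prop :=
  forall (s t : J) (p : P s) (q : P t) (p' : P' s) (q' : P' t) (f : hom s t),
    lmap Z p q f = lmap Z' p' q' f.

End Lifts.

Definition below (m : nat) : pred nat := fun n => n < m.
Definition level (m : nat) : pred nat := fun n => n == m.

Lemma below_succ m n : below m n -> below m.+1 n.
Proof. exact: leqW. Qed.

Lemma below_pred m n : below m n -> n <= m.-1.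
Proof. by case: m. Qed.

Lemma level_below m n : level m n -> below m.+1 n.
Proof. by move=> /eqP ->; exact: ltnSn. Qed.

Lemma below_level m n : below m.+1 n -> ~~ below m n -> level m n.
Proof.
by rewrite /below /level ltnS -leqNgt eqn_leq => -> ->.
Qed.

Definition below_dec m n : {below m n} + {~~ below m n} :=
  match boolP (below m n) with
  | AltTrue h => left h
  | AltFalse h => right h
  end.

Section Arrows.
Variables (J : weak_lattice) (x : J) (k : nat).

(** For [y] in J^x_k and [m <= k < deg x], the condition [arr_in] is automatic
    when [d] is [below m] or [level m]. *)
Record arrow (y : J) (d : pred nat) := Arrow {
  tgt : J;
  arr : hom y tgt;
  arr_in : boundary x k tgt;
  arr_deg : d (deg tgt)
}.

Definition arrow_comp (y : J) (d e : pred nat) (a : arrow y d)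
    (b : arrow (tgt a) e) : arrow y e :=
  Arrow (arr b ∘ arr a) (arr_in b) (arr_deg b).

Definition arrow_sub (y : J) (d e : pred nat) (h : forall n, d n -> e n)
    (a : arrow y d) : arrow y e :=
  Arrow (arr a) (arr_in a) (h _ (arr_deg a)).

Lemma arrow_under (a : arrow x (below k)) : under x k.-1 (tgt a).
Proof.
case: (arr_in a) => -[hx _] _; split=> //; right.
exact: (below_pred (arr_deg a)).
Qed.

Lemma under_self (n : nat) : under x n x.
Proof. by split; [exact: (inhabits (idm x)) | left]. Qed.

End Arrows.
Arguments arrow_comp {J x k y d e} a b.

Section Matching.
Variables (E : model_category) (J : weak_lattice) (Yt : functor J (ho E)).
Variables (x : J) (k : nat) (Y : lift Yt (boundary x k)).

Definition compatible (y : J) (m : nat) (Z : E)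
    (t : forall a : arrow x k y (below m), hom Z (obj Yt (tgt a))) : Prop :=
  forall (a b : arrow x k y (below m)) (h : hom (tgt a) (tgt b)),
    h ∘ arr a = arr b -> lmap Y (arr_in a) (arr_in b) h ∘ t a = t b.

(** [matching y m] is the type of limits of [(f : y -> s) |-> Y s] over the
    maps to objects of degree strictly below [m], so that its elements are the
    matching objects M^y_{m-1}. *)
Record matching (y : J) (m : nat) := Matching {
  mt_ob :> E;
  mt_proj : forall a : arrow x k y (below m), hom mt_ob (obj Yt (tgt a));
  mt_cone : compatible mt_proj;
  mt_tuple : forall (Z : E)
      (t : forall a : arrow x k y (below m), hom Z (obj Yt (tgt a))),
    compatible t -> hom Z mt_ob;
  mt_proj_tuple : forall (Z : E)
      (t : forall a : arrow x k y (below m), hom Z (obj Yt (tgt a)))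
      (h : compatible t) a,
    mt_proj a ∘ mt_tuple h = t a;
  mt_ext : forall (Z : E) (u v : hom Z mt_ob),
    (forall a, mt_proj a ∘ u = mt_proj a ∘ v) -> u = v
}.

(** All these limits are finite: as non-identity maps lower the degree, there
    are finitely many maps out of each object of [J]. *)
Record limit_choices := LimitChoices {
  lc_prod : forall (y : J) (d : pred nat) (X : arrow x k y d -> E), product X;
  lc_times : forall X Z : E, binary_product X Z;
  lc_pb : forall (U V W : E) (f : hom U W) (g : hom V W), pullback f g;
  lc_match : forall (y : J) (m : nat), matching y m
}.

Lemma matching_map_compatible (s : J) (m : nat) (p : boundary x k s) :
  compatible (fun a : arrow x k s (below m) => lmap Y p (arr_in a) (arr a)).
Proof. by move=> a b h <-; rewrite (lmap_comp Y p (arr_in a) (arr_in b)). Qed.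

(** The canonical map m^s_{m-1} : Y(s) -> M^s_{m-1}. *)
Definition matching_map (s : J) (m : nat) (M : matching s m)
    (p : boundary x k s) : hom (obj Yt s) M :=
  mt_tuple M (@matching_map_compatible s m p).

(** For [deg s = 0] the target is a terminal object (an empty limit), and the
    condition says that Y(s) is fibrant. *)
Definition reedy_fibrant : Prop :=
  forall (s : J) (p : boundary x k s) (M : matching s (deg s)),
    fib (matching_map M p).

End Matching.
Arguments mt_proj {E J Yt x k Y y m} M a : rename.
Arguments mt_tuple {E J Yt x k Y y m} M {Z t} h : rename.
Arguments mt_proj_tuple {E J Yt x k Y y m} M {Z t} h a : rename.
Arguments mt_ext {E J Yt x k Y y m} M {Z u v} _ : rename.
Arguments mt_cone {E J Yt x k Y y m} M {a b h} e : rename.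

Section Towers.
Variable E : category.

(** [base <- up 0 <- up 1 <- ...] *)
Record tower (base : E) := Tower {
  up : nat -> E;
  down0 : hom (up 0) base;
  downS : forall l, hom (up l.+1) (up l)
}.

Definition tower_ob (base : E) (T : tower base) (l : nat) : E :=
  if l is l'.+1 then up T l' else base.

Definition tower_down (base : E) (T : tower base) (l : nat) :
    hom (tower_ob T l.+1) (tower_ob T l) :=
  match l with 0 => down0 T | l'.+1 => downS T l' end.

(** For [s 0 <- s 1 <- ...] and [h : M -> s n], [splice n s M] is
    [s 0 <- ... <- s n <- M <- M <- M <- ...], with identities beyond the
    first [M]. *)
Fixpoint splice (n : nat) (s : nat -> E) (M : E) (l : nat) {struct l} : E :=
  match l with
  | 0 => s 0
  | l'.+1 =>
      match n with
      | 0 => M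
      | n'.+1 => splice n' (fun i => s i.+1) M l'
      end
  end.

Fixpoint splice_down (n : nat) :
    forall (s : nat -> E) (d : forall l, hom (s l.+1) (s l)) (M : E)
      (h : hom M (s n)) (l : nat),
      hom (splice n s M l.+1) (splice n s M l) :=
  match n return forall (s : nat -> E) (d : forall l, hom (s l.+1) (s l))
      (M : E) (h : hom M (s n)) (l : nat),
      hom (splice n s M l.+1) (splice n s M l) with
  | 0 => fun s d M h l =>
      match l return hom (splice 0 s M l.+1) (splice 0 s M l) with
      | 0 => h
      | _.+1 => idm M
      end
  | n'.+1 => fun s d M h l =>
      match l return hom (splice n'.+1 s M l.+1) (splice n'.+1 s M l) with
      | 0 => d 0
      | l'.+1 => @splice_down n' (fun i => s i.+1) (fun i => d i.+1) M h l'
      end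
  end.

(** The cone over the spliced tower made of [c 0, ..., c n, e, e, ...]. *)
Fixpoint splice_leg (n : nat) (s : nat -> E) (M X : E)
    (c : forall l, hom X (s l)) (e : hom X M) (l : nat) {struct l} :
    hom X (splice n s M l) :=
  match l return hom X (splice n s M l) with
  | 0 => c 0
  | l'.+1 =>
      match n return hom X (splice n s M l'.+1) with
      | 0 => e
      | n'.+1 => @splice_leg n' (fun i => s i.+1) M X (fun i => c i.+1) e l'
      end
  end.

Lemma splice_leg_down (n : nat) (s : nat -> E)
    (d : forall l, hom (s l.+1) (s l)) (M : E) (h : hom M (s n))
    (X : E) (c : forall l, hom X (s l)) (e : hom X M) :
  (forall l, d l ∘ c l.+1 = c l) -> h ∘ e = c n ->
  forall l, splice_down d h l ∘ splice_leg n c e l.+1 = splice_leg n c e l.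
Proof.
elim: n s d h c => [|n IH] s d h c hc he [|l] //=.
- exact: comp1m.
- by apply: (IH _ (fun i => d i.+1) h (fun i => c i.+1)) => // i; exact: hc.
Qed.

(** A column with rows [row 0 <- row 1 <- ...], to which both [S] and [top]
    map. *)
Record column (S : E) := Column {
  row : nat -> E;
  down : forall l, hom (row l.+1) (row l);
  from : forall l, hom S (row l);
  from_down : forall l, down l ∘ from l.+1 = from l;
  top : E;
  top_map : forall l, hom top (row l);
  top_down : forall l, down l ∘ top_map l.+1 = top_map l
}.

Variable S : E.

Fixpoint descend (c : column S) (l : nat) : hom (row c l) (row c 0) :=
  match l with 0 => idm _ | l'.+1 => descend c l' ∘ down c l' end.

Lemma descend_from (c : column S) l : descend c l ∘ from c l = from c 0.
Proof.
elim: l => [|l IH] /=; first exact: comp1m.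
by rewrite -compA from_down.
Qed.

Lemma descend_top (c : column S) l : descend c l ∘ top_map c l = top_map c 0.
Proof.
elim: l => [|l IH] /=; first exact: comp1m.
by rewrite -compA top_down.
Qed.

(** The object on the diagonal next to the bottom of a column. *)
Record diagonal (c : column S) := Diagonal {
  dg_ob : E;
  dg_q : hom dg_ob (row c 0);
  dg_phi : hom S dg_ob;
  dg_eq : dg_q ∘ dg_phi = from c 0
}.

Variable pb : forall (U V W : E) (f : hom U W) (g : hom V W), pullback f g.

Section Next.
Variables (c : column S) (g : diagonal c).

Definition next_row (l : nat) : pullback (dg_q g) (descend c l.+1) :=
  pb _ _.

Lemma next_down_eq l :
  dg_q g ∘ pb1 (next_row l.+1) = descend c l.+1 ∘ (down c l.+1 ∘ pb2 (next_row l.+1)).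
Proof. by rewrite pb_square compA. Qed.

Lemma next_from_eq l :
  dg_q g ∘ dg_phi g = descend c l.+1 ∘ from c l.+1.
Proof. by rewrite descend_from dg_eq. Qed.

Definition next_top : pullback (dg_q g) (top_map c 0) := pb _ _.

Lemma next_top_eq l :
  dg_q g ∘ pb1 next_top = descend c l.+1 ∘ (top_map c l.+1 ∘ pb2 next_top).
Proof. by rewrite pb_square compA descend_top. Qed.

Definition next_down l : hom (next_row l.+1) (next_row l) :=
  pb_pair (next_row l) (next_down_eq l).

Definition next_from l : hom S (next_row l) :=
  pb_pair (next_row l) (next_from_eq l).

Definition next_top_map l : hom next_top (next_row l) :=
  pb_pair (next_row l) (next_top_eq l).

Lemma next_from_down l : next_down l ∘ next_from l.+1 = next_from l.
Proof.
by apply: pb_ext; rewrite compA ?pb1_pair ?pb2_pair // -compA pb2_pair from_down.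
Qed.

Lemma next_top_down l : next_down l ∘ next_top_map l.+1 = next_top_map l.
Proof.
apply: pb_ext; rewrite compA ?pb1_pair ?pb2_pair //.
by rewrite -compA pb2_pair compA top_down.
Qed.

Definition next_column : column S := Column next_from_down next_top_down.

End Next.

End Towers.

Section Grid.
Variables (E : model_category) (J : weak_lattice) (Yt : functor J (ho E)).
Variables (x : J) (k : nat) (Y : lift Yt (boundary x k)).
Variable lc : limit_choices Y.

(** The factorizations used at [(y, m)]: [fc_F y m j] produces the object
    F^{j+1,j+1}, and [fc_G y m] the object G^{m-1,m+1}. *)
Record factor_choices := FactorChoices {
  fc_F : forall (y : J) (m j : nat) (U V : E) (f : hom U V),
    acf_factorization f;
  fc_G : forall (y : J) (m : nat) (U V : E) (f : hom U V), acf_factorization f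
}.
Variable fc : factor_choices.

Local Notation ar := (arrow x k).

(** M^y_{m-1} *)
Definition Mob (y : J) (m : nat) : matching Y y m := lc_match lc y m.

Lemma mt_proj_irr (y : J) (m : nat) (M : matching Y y m) (b : ar y (below m))
    (h : below m (deg (tgt b))) :
  mt_proj M (Arrow (arr b) (arr_in b) h) = mt_proj M b.
Proof.
by case: b h => t f p e h; rewrite /= (bool_irrelevance h e).
Qed.

Definition Aob (y : J) (m : nat) :
    product (fun a : ar y (level m) => obj Yt (tgt a)) :=
  lc_prod lc _.

Definition Bob (y : J) (m : nat) :
    product (fun b : ar y (below m) => obj Yt (tgt b)) :=
  lc_prod lc _.

Definition Lob (y : J) (m : nat) :
    product (fun a : ar y (level m) => Mob (tgt a) m : E) :=
  lc_prod lc _.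

Definition Dob (y : J) (m : nat) :
    product (fun a : ar y (level m) => Bob (tgt a) m : E) :=
  lc_prod lc _.

Definition Psi (y : J) (m : nat) : hom (Bob y m) (Dob y m) :=
  tuple (Dob y m) (fun a =>
    tuple (Bob (tgt a) m) (fun b => proj (Bob y m) (arrow_comp a b))).

Definition forget (y : J) (m : nat) : hom (Mob y m) (Bob y m) :=
  tuple (Bob y m) (mt_proj (Mob y m)).

Definition LtoD (y : J) (m : nat) : hom (Lob y m) (Dob y m) :=
  prod_map (Lob y m) (Dob y m) (fun a => forget (tgt a) m).

Definition AtoL (y : J) (m : nat) : hom (Aob y m) (Lob y m) :=
  prod_map (Aob y m) (Lob y m) (fun a => matching_map (Mob (tgt a) m) (arr_in a)).

(** Q^y_{m-1}, N^y_{m-1} and P^y_m. *)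
Definition Qob (y : J) (m : nat) : pullback (Psi y m) (LtoD y m) :=
  lc_pb lc _ _.

Definition QtoB (y : J) (m : nat) : hom (Qob y m) (Bob y m) := pb1 (Qob y m).
Definition QtoL (y : J) (m : nat) : hom (Qob y m) (Lob y m) := pb2 (Qob y m).

Definition Nob (y : J) (m : nat) : pullback (forget y m) (QtoB y m) :=
  lc_pb lc _ _.

Definition Pob (y : J) (m : nat) : pullback (QtoL y m) (AtoL y m) :=
  lc_pb lc _ _.

Section FromMatching.
Variables (y : J) (m : nat).

Lemma restrict_compatible :
  compatible Y (fun b : ar y (below m) =>
    mt_proj (Mob y m.+1) (arrow_sub (@below_succ m) b)).
Proof. by move=> a b h e; exact: (mt_cone (Mob y m.+1) (a:=arrow_sub (@below_succ m) a)
  (b:=arrow_sub (@below_succ m) b) (h:=h) e). Qed.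

Definition restrict : hom (Mob y m.+1) (Mob y m) :=
  mt_tuple (Mob y m) restrict_compatible.

Definition MtoA : hom (Mob y m.+1) (Aob y m) :=
  tuple (Aob y m) (fun a =>
    mt_proj (Mob y m.+1) (arrow_sub (@level_below m) a)).

Lemma MtoL_compatible (a : ar y (level m)) :
  compatible Y (fun b : ar (tgt a) (below m) =>
    mt_proj (Mob y m.+1) (arrow_sub (@below_succ m) (arrow_comp a b))).
Proof.
move=> b b' h e.
apply: (mt_cone (Mob y m.+1)
  (a:=arrow_sub (@below_succ m) (arrow_comp a b))
  (b:=arrow_sub (@below_succ m) (arrow_comp a b')) (h:=h)) => /=.
by rewrite compA e.
Qed.

Definition MtoL : hom (Mob y m.+1) (Lob y m) :=
  tuple (Lob y m) (fun a => mt_tuple (Mob (tgt a) m) (@MtoL_compatible a)).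

Lemma MtoQ_eq : Psi y m ∘ (forget y m ∘ restrict) = LtoD y m ∘ MtoL.
Proof.
apply: prod_ext => a.
rewrite (compA _ (Psi y m)) proj_tuple (compA _ (LtoD y m)) proj_tuple.
rewrite -(compA (forget _ m)) proj_tuple.
apply: prod_ext => b.
rewrite !(compA (proj _ b)) !proj_tuple.
rewrite mt_proj_tuple.
transitivity (proj (Bob y m) (arrow_comp a b) ∘ forget y m ∘ restrict).
  exact: compA.
rewrite proj_tuple.
exact: (mt_proj_tuple (Mob y m) restrict_compatible (arrow_comp a b)).
Qed.

Definition MtoQ : hom (Mob y m.+1) (Qob y m) := pb_pair (Qob y m) MtoQ_eq.

Lemma MtoN_eq : forget y m ∘ restrict = QtoB y m ∘ MtoQ.
Proof. by rewrite /QtoB pb1_pair. Qed.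

Definition MtoN : hom (Mob y m.+1) (Nob y m) := pb_pair (Nob y m) MtoN_eq.

Lemma MtoP_eq : QtoL y m ∘ MtoQ = AtoL y m ∘ MtoA.
Proof.
rewrite /QtoL pb2_pair; apply: prod_ext => a.
rewrite proj_tuple compA proj_tuple -compA proj_tuple.
apply: mt_ext => b; rewrite mt_proj_tuple compA mt_proj_tuple.
symmetry; exact: (mt_cone (Mob y m.+1)
  (a:=arrow_sub (@level_below m) a)
  (b:=arrow_sub (@below_succ m) (arrow_comp a b)) (h:=arr b)).
Qed.

Definition MtoP : hom (Mob y m.+1) (Pob y m) := pb_pair (Pob y m) MtoP_eq.

End FromMatching.

(** The objects F^{j,m+1}_{v,m} x G^{j,m+1}_{v,m} which a grid passes on to
    the next one, together with the map from M^v_m: [reduced v m.+1] is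
    F^{0,m+1} x G^{0,m+1} = \prod_{|u|<=m} Y(u) <- F^{1,m+1} x G^{1,m+1} <-
    ... <- F^{m-1,m+1} x G^{m-1,m+1} <- M^v_m <- M^v_m <- ... *)
Record reduced (v : J) (m : nat) := Reduced {
  rd_tower : tower (Bob v m : E);
  rd_leg : forall l, hom (Mob v m) (tower_ob rd_tower l);
  rd_leg0 : rd_leg 0 = forget v m;
  rd_leg_down : forall l, tower_down rd_tower l ∘ rd_leg l.+1 = rd_leg l
}.

Section Level.
Variables (m : nat) (T : forall v : J, reduced v m) (y : J).

(** Row [l] of column 0 is F^{0,l+1} for [l < m], and the top is F^{0,m+1}.  For
    [l = m-1] each factor is M^v_{m-1}, so that the product is L^y_m; the rows
    [l >= m] repeat it and are not used. *)
Definition row0 (l : nat) :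
    product (fun a : ar y (level m) => tower_ob (rd_tower (T (tgt a))) l) :=
  lc_prod lc _.

Definition down_0 (l : nat) : hom (row0 l.+1) (row0 l) :=
  prod_map (row0 l.+1) (row0 l) (fun a => tower_down (rd_tower (T (tgt a))) l).

Definition Lto0 (l : nat) : hom (Lob y m) (row0 l) :=
  prod_map (Lob y m) (row0 l) (fun a => rd_leg (T (tgt a)) l).

Lemma Lto0_down l : down_0 l ∘ Lto0 l.+1 = Lto0 l.
Proof.
apply: prod_ext => a; rewrite compA !proj_tuple -compA proj_tuple compA.
by rewrite rd_leg_down.
Qed.

Lemma Lto0_0 : Lto0 0 = LtoD y m.
Proof.
apply: (prod_ext (Dob y m)) => a.
rewrite (proj_tuple (row0 0)) (proj_tuple (Dob y m)).
by rewrite rd_leg0.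
Qed.

Lemma from0_down (X : E) (f : hom X (Lob y m)) l :
  down_0 l ∘ (Lto0 l.+1 ∘ f) = Lto0 l ∘ f.
Proof. by rewrite compA Lto0_down. Qed.

Definition column0 : column (Qob y m : E) :=
  Column (from0_down (QtoL y m)) (from0_down (AtoL y m)).

(** F^{1,1}, from the factorization of Psi; here phi^1 is not a cofibration. *)
Definition Psi_factor : acf_factorization (Psi y m) := fc_F fc y m 0 (Psi y m).

Definition iota : hom (Bob y m) (acf_mid Psi_factor) := acf_cof Psi_factor.

Lemma diagonal1_eq :
  acf_fib Psi_factor ∘ (iota ∘ QtoB y m) = from column0 0.
Proof. by rewrite compA acf_eq /= Lto0_0 /QtoB pb_square. Qed.

Definition diagonal1 : diagonal column0 :=
  @Diagonal E _ column0 (acf_mid Psi_factor) (acf_fib Psi_factor)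
    (iota ∘ QtoB y m) diagonal1_eq.

(** F^{j+1,j+1} for [j > 0]. *)
Definition diagonalS (j : nat) (c : column (Qob y m : E)) : diagonal c :=
  Diagonal (acf_eq (fc_F fc y m j (from c 0))).

(** Column [j] together with F^{j+1,j+1}. *)
Fixpoint stage (j : nat) : {c : column (Qob y m : E) & diagonal c} :=
  match j with
  | 0 => existT _ column0 diagonal1
  | j'.+1 =>
      let c := next_column (@lc_pb _ _ _ _ _ _ lc) (projT2 (stage j')) in
      existT _ c (diagonalS j'.+1 c)
  end.

(** In column [j], row [l] is F^{j,j+1+l} (for [j + 1 + l <= m]) and the top is
    F^{j,m+1}; the maps [from] are those induced from Q^y_{m-1}. *)
Definition col (j : nat) : column (Qob y m : E) := projT1 (stage j).

(** F^{j+1,j+1}, with q_{j+1} and phi^{j+1} (for [j + 1 < m]). *)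
Definition diag (j : nat) : diagonal (col j) := projT2 (stage j).

Definition next_col_row (j l : nat) :
    pullback (dg_q (diag j)) (descend (col j) l.+1) :=
  next_row (@lc_pb _ _ _ _ _ _ lc) (diag j) l.

Definition next_col_top (j : nat) :
    pullback (dg_q (diag j)) (top_map (col j) 0) :=
  next_top (@lc_pb _ _ _ _ _ _ lc) (diag j).

Lemma Ptop_eq (j : nat) (f : hom (Pob y m) (top (col j))) :
  (forall l, top_map (col j) l ∘ f = from (col j) l ∘ pb1 (Pob y m)) ->
  dg_q (diag j) ∘ (dg_phi (diag j) ∘ pb1 (Pob y m)) = top_map (col j) 0 ∘ f.
Proof. by move=> h; rewrite compA dg_eq h. Qed.

Lemma Ptop0_eq l :
  top_map (col 0) l ∘ pb2 (Pob y m) = from (col 0) l ∘ pb1 (Pob y m).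
Proof. by rewrite /= -!compA pb_square. Qed.

Lemma PtopS_eq (j : nat) (f : hom (Pob y m) (top (col j)))
    (h : forall l, top_map (col j) l ∘ f = from (col j) l ∘ pb1 (Pob y m)) l :
  top_map (col j.+1) l ∘ pb_pair (next_col_top j) (Ptop_eq h)
  = from (col j.+1) l ∘ pb1 (Pob y m).
Proof.
apply: (pb_ext (next_col_row j l)); rewrite !compA.
- by rewrite !(pb1_pair (next_col_row j l)) pb1_pair.
- rewrite !(pb2_pair (next_col_row j l)) -compA pb2_pair.
  exact: h.
Qed.

Fixpoint Ptop_data (j : nat) :
    {f : hom (Pob y m) (top (col j)) |
      forall l, top_map (col j) l ∘ f = from (col j) l ∘ pb1 (Pob y m)} :=
  match j with
  | 0 => exist _ (pb2 (Pob y m)) Ptop0_eq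
  | j'.+1 => exist _ (pb_pair (next_col_top j') (Ptop_eq (proj2_sig (Ptop_data j'))))
               (PtopS_eq (proj2_sig (Ptop_data j')))
  end.

(** P^y_m -> F^{j,m+1} *)
Definition Ptop (j : nat) : hom (Pob y m) (top (col j)) := proj1_sig (Ptop_data j).

Definition top_next (j : nat) : hom (top (col j.+1)) (top (col j)) :=
  pb2 (next_col_top j).

Lemma top_next_P (j : nat) : top_next j ∘ Ptop j.+1 = Ptop j.
Proof. exact: pb2_pair. Qed.

(** B^y_m x_{D^y_m} F^{0,j+1}, where F^{0,j+1} is row [j] of column 0. *)
Definition Gpb (j : nat) : pullback (Psi y m) (descend column0 j) := lc_pb lc _ _.

Lemma Gpb_down_eq j :
  Psi y m ∘ pb1 (Gpb j.+1) = descend column0 j ∘ (down_0 j ∘ pb2 (Gpb j.+1)).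
Proof. by rewrite pb_square compA. Qed.

Definition Gpb_down (j : nat) : hom (Gpb j.+1) (Gpb j) :=
  pb_pair (Gpb j) (Gpb_down_eq j).

Lemma QtoGpb_eq j :
  Psi y m ∘ QtoB y m = descend column0 j ∘ from column0 j.
Proof. by rewrite descend_from /= Lto0_0 /QtoB pb_square. Qed.

Definition QtoGpb (j : nat) : hom (Qob y m) (Gpb j) := pb_pair (Gpb j) (QtoGpb_eq j).

Lemma QtoGpb_down j : Gpb_down j ∘ QtoGpb j.+1 = QtoGpb j.
Proof.
apply: pb_ext; rewrite compA ?pb1_pair ?pb2_pair //.
by rewrite -compA pb2_pair; exact: from0_down.
Qed.

Definition NtoQ : hom (Nob y m) (Qob y m) := pb2 (Nob y m).

Definition G_factor : acf_factorization (QtoGpb m.-2 ∘ NtoQ) :=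
  fc_G fc y m (QtoGpb m.-2 ∘ NtoQ).

(** G^{j,m+1} is [Gpb j] for [j <= m-2] and the middle object of the
    factorization for [j = m-1]. *)
Definition Gob : nat -> E := splice m.-2 Gpb (acf_mid G_factor).

Definition Gdown : forall j, hom (Gob j.+1) (Gob j) :=
  splice_down Gpb_down (acf_fib G_factor).

Definition NtoG : forall j, hom (Nob y m) (Gob j) :=
  splice_leg m.-2 (fun j => QtoGpb j ∘ NtoQ) (acf_cof G_factor).

Lemma NtoG_down j : Gdown j ∘ NtoG j.+1 = NtoG j.
Proof.
apply: splice_leg_down; last exact: acf_eq.
by move=> l; rewrite compA QtoGpb_down.
Qed.

Definition FG (j : nat) : binary_product (top (col j) : E) (Gob j) :=
  lc_times lc _ _.

Definition FGdown (j : nat) : hom (FG j.+1) (FG j) :=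
  bpair (FG j) (top_next j ∘ bfst (FG j.+1)) (Gdown j ∘ bsnd (FG j.+1)).

Definition MtoFG (j : nat) : hom (Mob y m.+1) (FG j) :=
  bpair (FG j) (Ptop j ∘ MtoP y m) (NtoG j ∘ MtoN y m).

Lemma MtoFG_down j : FGdown j ∘ MtoFG j.+1 = MtoFG j.
Proof.
apply: bp_ext; rewrite compA ?bfst_pair ?bsnd_pair -compA
  ?bfst_pair ?bsnd_pair compA ?top_next_P ?NtoG_down //.
Qed.

(** [Gpb 0] is B^y_m x_{D^y_m} D^y_m, hence a copy of B^y_m = G^{0,m+1}.  The
    identification of F^{0,m+1} x G^{0,m+1} = A^y_m x B^y_m with
    \prod_{|u|<=m} Y(u). *)
Definition FG0_component (b : ar y (below m.+1)) :
    hom (FG 0) (obj Yt (tgt b)) :=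
  match below_dec m (deg (tgt b)) with
  | left h => proj (Bob y m) (Arrow (arr b) (arr_in b) h)
      ∘ (pb1 (Gpb 0) ∘ bsnd (FG 0))
  | right h => proj (Aob y m)
      (Arrow (arr b) (arr_in b) (below_level (arr_deg b) h))
      ∘ bfst (FG 0)
  end.

Definition FG0_merge : hom (FG 0) (Bob y m.+1) :=
  tuple (Bob y m.+1) FG0_component.

Lemma NtoG_0 : pb1 (Gpb 0) ∘ (NtoG 0 ∘ MtoN y m) = forget y m ∘ restrict y m.
Proof.
transitivity (pb1 (Gpb 0) ∘ (QtoGpb 0 ∘ NtoQ ∘ MtoN y m)) => //.
by rewrite !compA pb1_pair -compA pb2_pair MtoN_eq.
Qed.

Lemma Ptop_0 : Ptop 0 ∘ MtoP y m = MtoA y m.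
Proof. exact: pb2_pair. Qed.

Lemma MtoFG0_merge : FG0_merge ∘ MtoFG 0 = forget y m.+1.
Proof.
apply: prod_ext => b; rewrite compA !proj_tuple /FG0_component.
case: below_dec => h.
- set b' := Arrow _ _ _.
  rewrite -!compA bsnd_pair NtoG_0.
  transitivity (proj (Bob y m) b' ∘ forget y m ∘ restrict y m).
    exact: compA.
  rewrite proj_tuple.
  rewrite (mt_proj_tuple _ (restrict_compatible (y:=y) (m:=m)) b').
  exact: mt_proj_irr.
- set b' := Arrow _ _ _.
  rewrite -!compA bfst_pair Ptop_0.
  rewrite (proj_tuple (Aob y m) _ b').
  exact: mt_proj_irr.
Qed.

Definition next_tower : tower (Bob y m.+1 : E) :=
  @Tower E (Bob y m.+1) (splice m.-2 (fun j => FG j.+1) (Mob y m.+1))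
    (FG0_merge ∘ FGdown 0)
    (splice_down (fun j => FGdown j.+1) (MtoFG m.-2.+1)).

Definition next_leg (l : nat) : hom (Mob y m.+1) (tower_ob next_tower l) :=
  match l return hom (Mob y m.+1) (tower_ob next_tower l) with
  | 0 => forget y m.+1
  | l'.+1 => splice_leg m.-2 (fun j => MtoFG j.+1) (idm _) l'
  end.

Lemma next_leg_down l :
  tower_down next_tower l ∘ next_leg l.+1 = next_leg l.
Proof.
case: l => [|l].
  transitivity (FG0_merge ∘ FGdown 0 ∘ MtoFG 1) => //.
  by rewrite -compA MtoFG_down MtoFG0_merge.
apply: splice_leg_down; last exact: compm1.
by move=> j; exact: MtoFG_down.
Qed.

Definition next_reduced : reduced y m.+1 := Reduced erefl next_leg_down.

End Level.

(** For [m <= 2] there is only the map M^v_{m-1} -> \prod_{|u|<m} Y(u). *)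
Section Base.
Variables (v : J) (m : nat).

Definition base_tower : tower (Bob v m : E) :=
  @Tower E (Bob v m) (fun _ => Mob v m) (forget v m) (fun _ => idm _).

Definition base_leg (l : nat) : hom (Mob v m) (tower_ob base_tower l) :=
  match l return hom (Mob v m) (tower_ob base_tower l) with
  | 0 => forget v m
  | _.+1 => idm _
  end.

Lemma base_leg_down l : tower_down base_tower l ∘ base_leg l.+1 = base_leg l.
Proof. by case: l => [|l]; exact: compm1. Qed.

Definition base_reduced : reduced v m := Reduced erefl base_leg_down.

End Base.

(** [reduced_at m v] is obtained from the grid for [(v, m-1)] when
    [m - 1 >= 2]. *)
Fixpoint reduced_at (m : nat) : forall v : J, reduced v m :=
  match m return forall v : J, reduced v m with
  | 0 => fun v => base_reduced v 0
  | n.+1 =>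
      if 2 <= n then fun v => next_reduced (reduced_at n) v
      else fun v => base_reduced v n.+1
  end.

(** Column [j] of the grid for [(y, m)], and F^{j+1,j+1}_{y,m}. *)
Definition Fcol (y : J) (m j : nat) : column (Qob y m : E) :=
  col (reduced_at m) y j.

Definition Fdiag (y : J) (m j : nat) : diagonal (Fcol y m j) :=
  diag (reduced_at m) y j.

End Grid.

Section Operations.
Variables (E : model_category) (J : weak_lattice) (Yt : functor J (ho E)).
Variables (x : J) (k : nat) (Y : lift Yt (boundary x k)).
Variables (lc : limit_choices Y) (fc : factor_choices E J).
Variables (Y' : lift Yt (under x k.-1)) (YY' : agree Y Y').
Variable sigma_k : hom (obj Yt x) (Aob lc x k).

Local Notation Yx := (obj Yt x).
Local Notation Fc := (Fcol lc fc x k).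
Local Notation Fd := (Fdiag lc fc x k).

(** Y^x_{k-1}(f) for [f : x -> t] with [deg t < k]. *)
Definition Y'_map (b : arrow x k x (below k)) : hom Yx (obj Yt (tgt b)) :=
  lmap Y' (under_self x k.-1) (arrow_under b) (arr b).

Definition sigma_lt : hom Yx (Bob lc x k) := tuple (Bob lc x k) Y'_map.

Lemma sigma_L_compatible (a : arrow x k x (level k)) :
  compatible Y (fun b : arrow x k (tgt a) (below k) => Y'_map (arrow_comp a b)).
Proof.
move=> b b' h e.
rewrite (YY' _ _ (arrow_under (arrow_comp a b)) (arrow_under (arrow_comp a b'))).
by rewrite /Y'_map -lmap_comp /= compA e.
Qed.

Definition sigma_L : hom Yx (Lob lc x k) :=
  tuple (Lob lc x k) (fun a => mt_tuple (Mob lc (tgt a) k) (@sigma_L_compatible a)).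

Lemma eta_eq : Psi lc x k ∘ sigma_lt = LtoD lc x k ∘ sigma_L.
Proof.
apply: prod_ext => a.
rewrite (compA _ (Psi lc x k)) proj_tuple (compA _ (LtoD lc x k)) proj_tuple.
rewrite -(compA (forget lc _ k)) proj_tuple.
apply: prod_ext => b.
rewrite !(compA (proj _ b)) !proj_tuple mt_proj_tuple.
exact: (proj_tuple (Bob lc x k) Y'_map (arrow_comp a b)).
Qed.

(** eta_{k-1} : Y(x) -> Q^x_{k-1} *)
Definition eta : hom Yx (Qob lc x k) := pb_pair (Qob lc x k) eta_eq.

(** F^{1,k} *)
Definition F1k : pullback (dg_q (Fd 0)) (descend (Fc 0) (k.-2).+1) :=
  next_col_row fc (reduced_at lc fc k) x 0 k.-2.

Definition F1k_to_F11 : hom F1k (dg_ob (Fd 0)) := pb1 F1k.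

Definition Gamma : hom (Qob lc x k) F1k := from (Fc 1) k.-2.

Definition total_condition (theta : hom Yx F1k) : Prop :=
  homotopic (F1k_to_F11 ∘ theta) (iota lc fc k x ∘ sigma_lt) /\
  dg_q (Fd 0) ∘ (F1k_to_F11 ∘ theta)
    = LtoD lc x k ∘ AtoL lc x k ∘ sigma_k.

Definition total_operation (c : hom Yx F1k -> Prop) : Prop :=
  exists theta : hom Yx F1k, total_condition theta /\ c = homotopy_class theta.

Definition total_vanishes : Prop :=
  total_operation (homotopy_class (Gamma ∘ eta)).

(** In the separated operations, [j] is counted from [0]: the operation
    below is the one of order [j + 2], with values in F^{j+1,j+2}, and is
    meaningful for [j + 1 < k]. *)

(** F^{j+1,j+2} *)
Definition Fstep (j : nat) : pullback (dg_q (Fd j)) (descend (Fc j) 1) :=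
  next_col_row fc (reduced_at lc fc k) x j 0.

(** r_{j+1}, p_{j+1}, u_{j+1}, Phi^{j+1} and beta_j *)
Definition rmap (j : nat) : hom (Fstep j) (dg_ob (Fd j)) := pb1 (Fstep j).
Definition pmap (j : nat) : hom (Fstep j) (row (Fc j) 1) := pb2 (Fstep j).
Definition umap (j : nat) : hom (top (Fc j.+1)) (top (Fc j)) :=
  top_next fc (reduced_at lc fc k) x j.
Definition Phimap (j : nat) : hom (top (Fc j.+1)) (Fstep j) := top_map (Fc j.+1) 0.
Definition betamap (j : nat) : hom (top (Fc j)) (row (Fc j) 1) := top_map (Fc j) 1.

(** q_{j+2} o phi^{j+2} : Q^x_{k-1} -> F^{j+1,j+2}.  For [j + 2 < k] this is the
    factorization of the map induced from Q^x_{k-1}, and for [j + 2 = k] it is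
    gamma_k o Id. *)
Definition qphi (j : nat) : hom (Qob lc x k) (Fstep j) := from (Fc j.+1) 0.

Lemma qphiE (j : nat) : dg_q (Fd j.+1) ∘ dg_phi (Fd j.+1) = qphi j.
Proof. exact: dg_eq. Qed.

Definition sep_condition (j : nat) (kappa : hom Yx (top (Fc j)))
    (theta : hom Yx (Fstep j)) : Prop :=
  homotopic (rmap j ∘ theta) (dg_phi (Fd j) ∘ eta) /\
  pmap j ∘ theta = betamap j ∘ kappa.

Definition sep_operation (j : nat) (kappa : hom Yx (top (Fc j)))
    (c : hom Yx (Fstep j) -> Prop) : Prop :=
  exists theta : hom Yx (Fstep j),
    sep_condition kappa theta /\ c = homotopy_class theta.

Definition sep_vanishes_at (j : nat) (theta : hom Yx (Fstep j)) : Prop :=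
  homotopic theta (qphi j ∘ eta).

Definition sep_determines (j : nat) (kappa : hom Yx (top (Fc j)))
    (theta : hom Yx (Fstep j)) (kappa' : hom Yx (top (Fc j.+1))) : Prop :=
  umap j ∘ kappa' = kappa /\ Phimap j ∘ kappa' = theta.

(** [kappa] is obtained from [sigma_k] by choosing successively [j] maps at
    which the operations of orders [2, ..., j + 1] vanish. *)
Inductive sep_chain : forall j : nat, hom Yx (top (Fc j)) -> Prop :=
| SepChain0 : sep_chain (j:=0) sigma_k
| SepChainS (j : nat) (kappa : hom Yx (top (Fc j))) (theta : hom Yx (Fstep j))
    (kappa' : hom Yx (top (Fc j.+1))) :
    sep_chain kappa -> sep_condition kappa theta -> sep_vanishes_at theta ->
    sep_determines kappa theta kappa' -> sep_chain kappa'.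

Definition sequence_vanishes : Prop :=
  exists kappa : hom Yx (top (Fc k.-1)), sep_chain kappa.

(** The operations form a sequence of [k - 1] successive obstructions: the
    first one is defined, every element of an operation determines the map
    needed for the next one, and the next one is defined (i.e. non-empty) if
    the operation vanishes at that element. *)
Definition separates : Prop :=
  (exists c, sep_operation (j:=0) sigma_k c) /\
  forall (j : nat) (kappa : hom Yx (top (Fc j))) (theta : hom Yx (Fstep j)),
    j.+1 < k -> sep_chain kappa -> sep_condition kappa theta ->
    exists kappa' : hom Yx (top (Fc j.+1)),
      unique (sep_determines kappa theta) kappa' /\
      (sep_vanishes_at theta -> j.+2 < k -> exists c, sep_operation kappa' c).

End Operations.

(* Main.v *)
(** Write L, A for L^x_k, A^x_k.  A strict extension as in (1) is the same as a
    map s : Y(x) -> A lying over the map Y(x) -> L given by Y^x_{k-1}, with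
    components representing the prescribed homotopy classes.  As Y(x) is
    cofibrant and all Y(t) are fibrant, such an s is a map homotopic to
    sigma_k, and as A -> L is a fibration (a product of matching maps), it
    exists iff the composite of sigma_k with A -> L is homotopic to the map
    given by Y^x_{k-1}.

    Vanishing of the total operation, or of the last separated operation,
    yields this homotopy by projecting from F^{1,k}, or F^{k-1,k}, to
    F^{0,k} = L.  Conversely, given s, the homotopy is lifted along the fibration
    F^{1,k} -> F^{0,k}, or successively along the fibrations
    F^{j+1,k+1} -> F^{j,k+1}, starting from the maps Y(x) -> P^x_k -> F^{j,k+1}
    induced by s.  Since these lifts only use homotopies out of a cofibrant
    object, fibrancy of the objects of the grid plays no role. *)

From Stdlib Require Import List FinFun ProofIrrelevance ClassicalEpsilon.
From Stdlib Require Import FunctionalExtensionality PropExtensionality.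
From mathcomp Require Import ssreflect ssrfun ssrbool eqtype ssrnat.
Require Import Defs.

Set Implicit Arguments.
Unset Strict Implicit.
Unset Printing Implicit Defensive.

(** * Homotopies in a model category *)

Section FiniteLimits.
Variable C : category.

Definition empty_category : category :=
  @Category Empty_set (fun _ _ => Empty_set) (fun i => match i with end)
    (fun i => match i with end) (fun i => match i with end)
    (fun i => match i with end) (fun i => match i with end).

Definition empty_functor : functor empty_category C.
Proof.
by refine (@Functor empty_category C (Empty_set_rect _)
  (fun _ _ (f : Empty_set) => match f with end) _ _); case.
Defined.

Lemma terminal_exists : has_finite_limits C -> exists T : C, is_terminal T.
Proof.
move=> lim.
have fin : Finite empty_category by exists nil; case.
have finh (i j : empty_category) : Finite (hom i j) by case: i.
have [T [pr [_ univ]]] := lim empty_category fin finh empty_functor; exists T => X.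
have [|u [_ uniq]] := univ X (fun i : Empty_set => match i with end); first by case.
by exists u; split=> // v _; apply: uniq; case.
Qed.

(** [None] is the corner of the cospan. *)
Definition cospan_rel (i j : option bool) : bool :=
  if j is Some b then i == Some b else true.

Lemma cospan_rel_refl i : cospan_rel i i.
Proof. by case: i => [b|] /=. Qed.

Lemma cospan_rel_trans i j l : cospan_rel j l -> cospan_rel i j -> cospan_rel i l.
Proof. by case: l => // b /= /eqP ->. Qed.

Definition cospan : category.
Proof.
refine (@Category (option bool) (fun i j => cospan_rel i j) cospan_rel_refl
  (fun i j l => @cospan_rel_trans i j l) _ _ _); move=> *; exact: bool_irrelevance.
Defined.

Section Pullback.
Variables (X Y Z : C) (f : hom X Z) (g : hom Y Z).

Definition cospan_ob (i : option bool) : C :=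
  match i with Some true => X | Some false => Y | None => Z end.

Definition cospan_map (i j : option bool) :
    cospan_rel i j -> hom (cospan_ob i) (cospan_ob j) :=
  match i, j return cospan_rel i j -> hom (cospan_ob i) (cospan_ob j) with
  | Some true, Some true => fun _ => idm X
  | Some false, Some false => fun _ => idm Y
  | None, None => fun _ => idm Z
  | Some true, None => fun _ => f
  | Some false, None => fun _ => g
  | Some true, Some false => fun h => False_rect _ (Bool.diff_false_true h)
  | Some false, Some true => fun h => False_rect _ (Bool.diff_false_true h)
  | None, Some _ => fun h => False_rect _ (Bool.diff_false_true h)
  end.

Definition cospan_functor : functor cospan C.
Proof.
refine (@Functor cospan C cospan_ob cospan_map _ _).
- by move=> [[]|].
- by move=> [[]|] [[]|] [[]|] //= h h'; rewrite ?comp1m ?compm1.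
Defined.

(** The universal property is split into existence and joint monicity, a form that turns into the
    one of pushouts when applied to [op E]. *)
Lemma pullback_exists : has_finite_limits C -> exists (P : C) (a : hom P X) (b : hom P Y),
  [/\ f ∘ a = g ∘ b,
      forall W (u : hom W X) (v : hom W Y), f ∘ u = g ∘ v ->
        exists w : hom W P, a ∘ w = u /\ b ∘ w = v
    & forall W (w w' : hom W P), a ∘ w = a ∘ w' -> b ∘ w = b ∘ w' -> w = w'].
Proof.
move=> lim.
have fin : Finite cospan.
  exists (Some true :: Some false :: None :: nil) => -[[]|] /=; tauto.
have finh (i j : cospan) : Finite (hom i j).
  rewrite /=; case e: (cospan_rel i j).
  - by exists (isT :: nil) => h; left; exact: bool_irrelevance.
  - by exists nil.
have [P [pr [cone univ]]] := lim cospan fin finh cospan_functor.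
have cf : f ∘ pr (Some true) = pr None by exact: (cone (Some true) None isT).
have cg : g ∘ pr (Some false) = pr None by exact: (cone (Some false) None isT).
exists P, (pr (Some true)), (pr (Some false)); split.
- by rewrite cf cg.
- move=> W u v e.
  pose t (i : cospan) : hom W (cospan_functor i) :=
    match i with Some true => u | Some false => v | None => f ∘ u end.
  have [|w [hw _]] := univ W t.
    by move=> [[]|] [[]|] //= h; rewrite ?comp1m.
  by exists w; split; [exact: (hw (Some true)) | exact: (hw (Some false))].
- move=> W w w' e1 e2.
  have [|u [_ uniq]] := univ W (fun i => pr i ∘ w).
    by move=> i j h; rewrite compA cone.
  rewrite -(uniq w) // -(uniq w') // => -[[]|]; rewrite ?e1 ?e2 //.
  by rewrite -cf -!compA e1.
Qed.
End Pullback.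

(** A product is a pullback over the terminal object. *)
Lemma product_exists (X Y : C) : has_finite_limits C ->
  exists (P : C) (a : hom P X) (b : hom P Y),
    (forall W (u : hom W X) (v : hom W Y), exists w : hom W P, a ∘ w = u /\ b ∘ w = v) /\
    (forall W (w w' : hom W P), a ∘ w = a ∘ w' -> b ∘ w = b ∘ w' -> w = w').
Proof.
move=> lim; have [T hT] := terminal_exists lim.
have [f _] := hT X; have [g _] := hT Y.
have [P [a [b [_ ex uniq]]]] := pullback_exists f g lim.
exists P, a, b; split=> // W u v; apply: ex.
have [t [_ ht]] := hT W.
by rewrite -(ht (f ∘ u)) // -(ht (g ∘ v)).
Qed.

End FiniteLimits.

(** * Lifting properties, fibrant and cofibrant objects *)

Section ModelCategory.
Variable E : model_category.
Implicit Types A B X Y Z W : E.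

Lemma pushout_exists X Y Z (f : hom Z X) (g : hom Z Y) :
  exists (P : E) (a : hom X P) (b : hom Y P),
  [/\ a ∘ f = b ∘ g,
      forall W (u : hom X W) (v : hom Y W), u ∘ f = v ∘ g ->
        exists w : hom P W, w ∘ a = u /\ w ∘ b = v
    & forall W (w w' : hom P W), w ∘ a = w' ∘ a -> w ∘ b = w' ∘ b -> w = w'].
Proof. exact: (@pullback_exists (op E) X Y Z f g (@mc_colim E)). Qed.

Lemma coproduct_exists X Y :
  exists (P : E) (a : hom X P) (b : hom Y P),
    (forall W (u : hom X W) (v : hom Y W), exists w : hom P W, w ∘ a = u /\ w ∘ b = v) /\
    (forall W (w w' : hom P W), w ∘ a = w' ∘ a -> w ∘ b = w' ∘ b -> w = w').
Proof. exact: (@product_exists (op E) X Y (@mc_colim E)). Qed.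

Lemma initial_exists : exists I : E, @is_terminal (op E) I.
Proof. exact: (@terminal_exists (op E) (@mc_colim E)). Qed.

(** Equivalent to [fib] by the two lemmas below; in this form the closure under pullbacks and
    products is immediate. *)
Definition rlp X Y (p : hom X Y) : Prop :=
  forall A B (i : hom A B), cof i -> weq i -> has_lifting i p.

Lemma fib_rlp X Y (p : hom X Y) : fib p -> rlp p.
Proof. by move=> fp A B i ci wi; exact: acyclic_cof_lift_fib. Qed.

(** Retract argument: a lift against the acyclic cofibration in a factorization of [p] exhibits [p]
    as a retract of the fibration. *)
Lemma rlp_fib X Y (p : hom X Y) : rlp p -> fib p.
Proof.
move=> h; have [Z [i [q [e ci wi fq]]]] := factor_acyclic_cof_fib p.
have [|r [ri pr]] := h _ _ i ci wi (idm X) q; first by rewrite compm1.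
apply: (@fib_retract E _ _ _ _ p q _ fq).
by exists i, r, (idm Y), (idm Y); split; rewrite ?comp1m.
Qed.

Lemma llp_cof A B (i : hom A B) :
  (forall X Y (p : hom X Y), fib p -> weq p -> has_lifting i p) -> cof i.
Proof.
move=> h; have [Z [j [q [e cj fq wq]]]] := factor_cof_acyclic_fib i.
have [|r [ri qr]] := h _ _ q fq wq j (idm B); first by rewrite comp1m.
apply: (@cof_retract E _ _ _ _ i j _ cj).
by exists (idm A), (idm A), r, q; split; rewrite ?comp1m ?compm1.
Qed.

Lemma llp_acyclic_cof A B (i : hom A B) :
  (forall X Y (p : hom X Y), fib p -> has_lifting i p) -> cof i /\ weq i.
Proof.
move=> h; split; first by apply: llp_cof => X Y p fp _; exact: h.
have [Z [j [q [e cj wj fq]]]] := factor_acyclic_cof_fib i.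
have [|r [ri qr]] := h _ _ q fq j (idm B); first by rewrite comp1m.
apply: (@weq_retract E _ _ _ _ i j _ wj).
by exists (idm A), (idm A), r, q; split; rewrite ?comp1m ?compm1.
Qed.

Lemma cofibrant_lift X Y Z (p : hom Y Z) (f : hom X Z) :
  cofibrant X -> fib p -> weq p -> exists g : hom X Y, p ∘ g = f.
Proof.
move=> cX fp wp; have [I hI] := initial_exists.
have [i _] := hI X; have [y _] := hI Y; have [z [_ hz]] := hI Z.
have [|g [_ pg]] := cof_lift_acyclic_fib (cX I hI i) fp wp (f:=y) (g:=f).
  by rewrite -(hz (p ∘ y)) // -(hz (f ∘ i)).
by exists g.
Qed.

Lemma fibrant_extend X A B (i : hom A B) (f : hom A X) :
  fibrant X -> cof i -> weq i -> exists g : hom B X, g ∘ i = f.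
Proof.
move=> fX ci wi; have [T hT] := terminal_exists (@mc_lim E).
have [p _] := hT X; have [b _] := hT B; have [a [_ ha]] := hT A.
have [|g [gi _]] := acyclic_cof_lift_fib ci wi (fX T hT p) (f:=f) (g:=b).
  by rewrite -(ha (p ∘ f)) // -(ha (b ∘ i)).
by exists g.
Qed.

(** Extensions are chosen in each factor separately, so [I] may be any type. *)
Lemma fibrant_product (I : Type) (X : I -> E) (p : product X) :
  (forall i, fibrant (X i)) -> fibrant p.
Proof.
move=> hX T hT f; apply: rlp_fib => A B j cj wj u v e.
pose w i := proj1_sig (constructive_indefinite_description _
  (fibrant_extend (proj p i ∘ u) (hX i) cj wj)).
have hw i : w i ∘ j = proj p i ∘ u.
  exact: proj2_sig (constructive_indefinite_description _
    (fibrant_extend (proj p i ∘ u) (hX i) cj wj)).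
exists (tuple p w); split.
- by apply: prod_ext => i; rewrite compA proj_tuple.
- by have [c [_ hc]] := hT B; rewrite -(hc v) // -(hc (f ∘ _)).
Qed.

Lemma rlp_pullback X Y Z (f : hom X Z) (g : hom Y Z) (P : pullback f g) :
  rlp f -> rlp (pb2 P).
Proof.
move=> hf A B i ci wi u v e.
have [|w [wi' fw]] := hf _ _ i ci wi (pb1 P ∘ u) (g ∘ v).
  by rewrite compA pb_square -!compA e.
exists (pb_pair P fw); split; last exact: pb2_pair.
by apply: pb_ext; rewrite compA ?pb1_pair ?pb2_pair.
Qed.

Lemma rlp_prod_map (I : Type) (X Y : I -> E) (p : product X) (q : product Y)
    (f : forall i, hom (X i) (Y i)) :
  (forall i, rlp (f i)) -> rlp (prod_map p q f).
Proof.
move=> hf A B j cj wj u v e.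
have ex i : exists w : hom B (X i), w ∘ j = proj p i ∘ u /\ f i ∘ w = proj q i ∘ v.
  apply: hf => //.
  by rewrite -compA -e !compA proj_tuple.
pose w i := proj1_sig (constructive_indefinite_description _ (ex i)).
have hw i : w i ∘ j = proj p i ∘ u /\ f i ∘ w i = proj q i ∘ v.
  exact: proj2_sig (constructive_indefinite_description _ (ex i)).
exists (tuple p w); split; apply: prod_ext => i; rewrite compA proj_tuple.
- exact: proj1 (hw i).
- by rewrite -compA proj_tuple; exact: proj2 (hw i).
Qed.

End ModelCategory.

(** * Cylinders, path objects and homotopies *)

Section Cylinders.
Variable E : model_category.
Implicit Types A B X Y Z W : E.

(** A good cylinder, with the lifting property of the cofibration
    [X + X -> C] in place of the coproduct. *)
Record good_cylinder X (C : E) (i0 i1 : hom X C) (s : hom C X) : Prop :=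
  GoodCylinder {
  gc_weq : weq s;
  gc_s0 : s ∘ i0 = idm X;
  gc_s1 : s ∘ i1 = idm X;
  gc_lift : forall U V (p : hom U V) (u0 u1 : hom X U) (v : hom C V),
    fib p -> weq p -> p ∘ u0 = v ∘ i0 -> p ∘ u1 = v ∘ i1 ->
    exists h : hom C U, [/\ h ∘ i0 = u0, h ∘ i1 = u1 & p ∘ h = v]
}.

(** The map from [X + X] to the cylinder is factored as a cofibration and an acyclic fibration [q],
    and [H] is pulled back along [q]. *)
Lemma left_homotopic_good X Y (f g : hom X Y) : left_homotopic f g ->
  exists (C : E) (i0 i1 : hom X C) (s : hom C X) (H : hom C Y),
    [/\ good_cylinder i0 i1 s, H ∘ i0 = f & H ∘ i1 = g].
Proof.
move=> [C [i0 [i1 [s [H [ws s0 s1 Hf Hg]]]]]].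
have [S [a [b [ex uniq]]]] := coproduct_exists X X.
have [i [ia ib]] := ex _ i0 i1.
have [C' [j [q [e cj fq wq]]]] := factor_cof_acyclic_fib i.
exists C', (j ∘ a), (j ∘ b), (s ∘ q), (H ∘ q); split.
- split.
  + exact: weq_comp.
  + by rewrite -compA (compA q) e ia.
  + by rewrite -compA (compA q) e ib.
  + move=> U V p u0 u1 v fp wp e0 e1.
    have [u [ua ub]] := ex _ u0 u1.
    have [|h [hj ph]] := cof_lift_acyclic_fib cj fp wp (f:=u) (g:=v).
      by apply: uniq; rewrite -!compA ?ua ?ub.
    by exists h; split=> //; rewrite compA hj.
- by rewrite -compA (compA q) e ia.
- by rewrite -compA (compA q) e ib.
Qed.

Lemma left_homotopic_refl X Y (f : hom X Y) : left_homotopic f f.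
Proof.
exists X, (idm X), (idm X), (idm X), f.
by split; rewrite ?compm1 //; exact: weq_id.
Qed.

Lemma left_homotopic_sym X Y (f g : hom X Y) :
  left_homotopic f g -> left_homotopic g f.
Proof.
move=> [C [i0 [i1 [s [H [ws s0 s1 Hf Hg]]]]]].
by exists C, i1, i0, s, H.
Qed.

Lemma left_homotopic_comp X Y Z (h : hom Y Z) (f g : hom X Y) :
  left_homotopic f g -> left_homotopic (h ∘ f) (h ∘ g).
Proof.
move=> [C [i0 [i1 [s [H [ws s0 s1 Hf Hg]]]]]].
by exists C, i0, i1, s, (h ∘ H); split=> //; rewrite -compA ?Hf ?Hg.
Qed.

Lemma right_homotopic_precomp X Y Z (h : hom X Y) (f g : hom Y Z) :
  right_homotopic f g -> right_homotopic (f ∘ h) (g ∘ h).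
Proof.
move=> [P [p0 [p1 [s [H [ws s0 s1 Hf Hg]]]]]].
by exists P, p0, p1, s, (H ∘ h); split=> //; rewrite compA ?Hf ?Hg.
Qed.

(** * Homotopies out of a cofibrant object *)

Section Cofibrant.
Variable X : E.
Hypothesis X_cof : cofibrant X.

(** The inclusions of [X] in [X + X] are pushouts of the cofibration from the
    initial object. *)
Lemma good_cylinder_acyclic_cof C (i0 i1 : hom X C) (s : hom C X) :
  good_cylinder i0 i1 s -> cof i0 /\ weq i0.
Proof.
move=> [ws s0 s1 lift]; split; last first.
  by apply: (weq_cancell ws); rewrite s0; exact: weq_id.
apply: llp_cof => U V p fp wp u0 v e.
have [u1 e1] := cofibrant_lift (v ∘ i1) X_cof fp wp.
by have [h [h0 _ ph]] := lift _ _ p u0 u1 v fp wp e e1; exists h.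
Qed.

(** As [i0] is an acyclic cofibration, the homotopy lifts starting from [f], and [f'] is the other
    end of the lift. This is how homotopies become strict equations. *)
Lemma homotopy_lifting Y Z (p : hom Y Z) (f : hom X Y) (g : hom X Z) :
  rlp p -> left_homotopic (p ∘ f) g ->
  exists f' : hom X Y, p ∘ f' = g /\ left_homotopic f f'.
Proof.
move=> hp /left_homotopic_good [C [i0 [i1 [s [H [gc H0 H1]]]]]].
have [c0 w0] := good_cylinder_acyclic_cof gc.
have [K [K0 pK]] := hp _ _ i0 c0 w0 f H (esym H0).
exists (K ∘ i1); split; first by rewrite compA pK.
exists C, i0, i1, s, K; split=> //.
- exact: gc_weq gc.
- exact: gc_s0 gc.
- exact: gc_s1 gc.
Qed.

(** Cylinders are glued by a pushout along the acyclic cofibration [i0]. *)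
Lemma left_homotopic_trans Y (f g h : hom X Y) :
  left_homotopic f g -> left_homotopic g h -> left_homotopic f h.
Proof.
move=> [C [i0 [i1 [s [H [ws s0 s1 Hf Hg]]]]]].
move=> /left_homotopic_good [C' [j0 [j1 [t [K [gc Kg Kh]]]]]].
have [c0 w0] := good_cylinder_acyclic_cof gc.
have [P [a [b [sq ex uniq]]]] := pushout_exists i1 j0.
have [|r [ra rb]] := ex _ s t; first by rewrite s1 (gc_s0 gc).
have [|L [La Lb]] := ex _ H K; first by rewrite Hg Kg.
(* [a] is a pushout of the acyclic cofibration [j0], so it lifts against fibrations; then [r] is a
   weak equivalence since [r ∘ a = s]. *)
have [_ wa] : cof a /\ weq a.
  apply: llp_acyclic_cof => U V p fp u v e.
  have [|w [w0' pw]] := acyclic_cof_lift_fib c0 w0 fp (f:=u ∘ i1) (g:=v ∘ b).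
    by rewrite compA e -!compA sq.
  have [|z [za zb]] := ex _ u w; first by rewrite w0'.
  exists z; split=> //.
  by apply: uniq; rewrite -compA ?za ?zb.
exists P, (a ∘ i0), (b ∘ j1), r, L; split.
- by apply: (weq_cancelr wa); rewrite ra.
- by rewrite compA ra.
- by rewrite compA rb (gc_s1 gc).
- by rewrite compA La.
- by rewrite compA Lb.
Qed.

(** The homotopy [C -> Y^I] starting at the constant path on [f] and with
    ends [f] and [H]. *)
Lemma left_right_homotopic Y (f g : hom X Y) :
  left_homotopic f g -> right_homotopic f g.
Proof.
move=> /left_homotopic_good [C [i0 [i1 [s [H [gc H0 H1]]]]]].
have [c0 w0] := good_cylinder_acyclic_cof gc.
have [S [a [b [ex uniq]]]] := product_exists Y Y (@mc_lim E).
have [d [ad bd]] := ex _ (idm Y) (idm Y).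
have [P [j [q [e cj wj fq]]]] := factor_acyclic_cof_fib d.
have [v [av bv]] := ex _ (f ∘ s) H.
have [|K [K0 qK]] := acyclic_cof_lift_fib c0 w0 fq (f:=j ∘ f) (g:=v).
  rewrite compA e; apply: uniq; rewrite !compA ?ad ?bd ?av ?bv comp1m ?H0 //.
  by rewrite -compA (gc_s0 gc) compm1.
exists P, (a ∘ q), (b ∘ q), j, (K ∘ i1); split=> //.
- by rewrite -compA e.
- by rewrite -compA e.
- by rewrite -compA (compA q) qK compA av -compA (gc_s1 gc) compm1.
- by rewrite -compA (compA q) qK compA bv.
Qed.

Lemma left_homotopicP Y (f g : hom X Y) : homotopic f g <-> left_homotopic f g.
Proof.
by split=> [[]//|h]; split=> //; exact: left_right_homotopic.
Qed.

(** Left homotopy is an equivalence relation here, which turns the membership of a class in the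
    total operation into a homotopy. *)
Lemma homotopy_class_eq Y (f g : hom X Y) :
  homotopy_class f = homotopy_class g <-> homotopic f g.
Proof.
split=> [e|/left_homotopicP h].
  change (homotopy_class f g); rewrite e.
  by apply/left_homotopicP; exact: left_homotopic_refl.
apply: functional_extensionality => u.
apply: propositional_extensionality.
split=> /left_homotopicP hu; apply/left_homotopicP.
- exact: left_homotopic_trans (left_homotopic_sym h) hu.
- exact: left_homotopic_trans h hu.
Qed.

End Cofibrant.

Lemma good_cylinder_exists X : exists (C : E) (i0 i1 : hom X C) (s : hom C X),
  good_cylinder i0 i1 s.
Proof.
have [C [i0 [i1 [s [H [gc _ _]]]]]] :=
  left_homotopic_good (left_homotopic_refl (idm X)).
by exists C, i0, i1, s.
Qed.

(** [S] is the product of two copies of [Y] with projections [a], [b]; the path object is replaced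
    by one whose end-point map [q] to [S] is a fibration. *)
Lemma right_homotopic_good X Y (f g : hom X Y) : right_homotopic f g ->
  exists (P S : E) (a b : hom S Y) (q : hom P S) (s : hom Y P) (H : hom X P),
  [/\ (forall W (u v : hom W Y), exists w : hom W S, a ∘ w = u /\ b ∘ w = v),
      (forall W (w w' : hom W S), a ∘ w = a ∘ w' -> b ∘ w = b ∘ w' -> w = w'),
      (fib q /\ weq s), a ∘ q ∘ s = idm Y /\ b ∘ q ∘ s = idm Y
    & a ∘ q ∘ H = f /\ b ∘ q ∘ H = g].
Proof.
move=> [P [p0 [p1 [s [H [ws s0 s1 Hf Hg]]]]]].
have [S [a [b [ex uniq]]]] := product_exists Y Y (@mc_lim E).
have [d [ad bd]] := ex _ p0 p1.
have [P' [j [q [e cj wj fq]]]] := factor_acyclic_cof_fib d.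
have aqj : a ∘ q ∘ j = p0 by rewrite -compA e.
have bqj : b ∘ q ∘ j = p1 by rewrite -compA e.
exists P', S, a, b, q, (j ∘ s), (j ∘ H); split=> //.
- by split=> //; exact: weq_comp.
- by rewrite !(compA _ j) aqj bqj.
- by rewrite !(compA _ j) aqj bqj.
Qed.

(** For fibrant [Y] the end-point map of a good path object is an acyclic
    fibration. *)
Lemma right_homotopic_cylinder X Y (f g : hom X Y)
    (C : E) (i0 i1 : hom X C) (s : hom C X) :
  fibrant Y -> good_cylinder i0 i1 s -> right_homotopic f g ->
  exists H : hom C Y, H ∘ i0 = f /\ H ∘ i1 = g.
Proof.
move=> fY gc /right_homotopic_good
  [P [S [a [b [q [t [K [ex uniq [fq wt] [ta tb] [Ka Kb]]]]]]]]].
have fa : fib a.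
  apply: rlp_fib => A B i ci wi u v e.
  have [w wi'] := fibrant_extend (b ∘ u) fY ci wi.
  have [z [za zb]] := ex _ v w.
  by exists z; split=> //; apply: uniq; rewrite compA ?za ?zb.
have faq : fib (a ∘ q) by exact: fib_comp.
have waq : weq (a ∘ q) by apply: (weq_cancelr wt); rewrite ta; exact: weq_id.
have [||h [h0 h1 _]] := gc_lift gc (u0:=t ∘ f) (u1:=K) (v:=f ∘ s) faq waq.
- by rewrite compA ta comp1m -compA (gc_s0 gc) compm1.
- by rewrite Ka -compA (gc_s1 gc) compm1.
exists (b ∘ q ∘ h); split; first by rewrite -compA h0 compA tb comp1m.
by rewrite -compA h1.
Qed.

Lemma right_left_homotopic X Y (f g : hom X Y) :
  fibrant Y -> right_homotopic f g -> left_homotopic f g.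
Proof.
move=> fY h; have [C [i0 [i1 [s gc]]]] := good_cylinder_exists X.
have [H [H0 H1]] := right_homotopic_cylinder fY gc h.
exists C, i0, i1, s, H; split=> //.
- exact: gc_weq gc.
- exact: gc_s0 gc.
- exact: gc_s1 gc.
Qed.

(** The component homotopies live on different cylinders. Passing through right homotopies moves
    them all to one good cylinder, where they form a tuple. *)
Lemma left_homotopic_product X (I : Type) (Y : I -> E) (p : product Y)
    (f g : hom X p) :
  cofibrant X -> (forall i, fibrant (Y i)) ->
  (forall i, left_homotopic (proj p i ∘ f) (proj p i ∘ g)) -> left_homotopic f g.
Proof.
move=> cX fY h; have [C [i0 [i1 [s gc]]]] := good_cylinder_exists X.
have ex i : exists H : hom C (Y i), H ∘ i0 = proj p i ∘ f /\ H ∘ i1 = proj p i ∘ g.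
  exact: right_homotopic_cylinder (fY i) gc (left_right_homotopic cX (h i)).
pose H i := proj1_sig (constructive_indefinite_description _ (ex i)).
have hH i : H i ∘ i0 = proj p i ∘ f /\ H i ∘ i1 = proj p i ∘ g.
  exact: proj2_sig (constructive_indefinite_description _ (ex i)).
exists C, i0, i1, s, (tuple p H); split.
- exact: gc_weq gc.
- exact: gc_s0 gc.
- exact: gc_s1 gc.
- by apply: prod_ext => i; rewrite compA proj_tuple; exact: proj1 (hH i).
- by apply: prod_ext => i; rewrite compA proj_tuple; exact: proj2 (hH i).
Qed.

(** The constant path on [f ∘ j] extends along [j] to a path from [f] to [g], by lifting against the
    end-point fibration. *)
Lemma acyclic_cof_right_homotopic A B Y (j : hom A B) (f g : hom B Y) :
  cof j -> weq j -> f ∘ j = g ∘ j -> right_homotopic f g.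
Proof.
move=> cj wj e.
have [S [a [b [ex uniq]]]] := product_exists Y Y (@mc_lim E).
have [d [ad bd]] := ex _ (idm Y) (idm Y).
have [P [t [q [e' ct wt fq]]]] := factor_acyclic_cof_fib d.
have [v [av bv]] := ex _ f g.
have [|H [_ qH]] := acyclic_cof_lift_fib cj wj fq (f:=t ∘ (f ∘ j)) (g:=v).
  rewrite compA e'; apply: uniq; rewrite !compA ?ad ?bd ?av ?bv comp1m //.
exists P, (a ∘ q), (b ∘ q), t, H; split=> //; rewrite -compA ?e' ?qH //.
Qed.

End Cylinders.

(** * Maps identified in the homotopy category *)

Section Localization.
Variable E : model_category.
Implicit Types X Y Z W : E.

(** After localization [i0] and [i1] are both the inverse of [s], hence equal. *)
Lemma gamma_left_homotopic X Y (f g : hom X Y) :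
  left_homotopic f g -> gamma_map f = gamma_map g.
Proof.
move=> [C [i0 [i1 [s [H [ws s0 s1 <- <-]]]]]].
have e : zz_eq (zz_fwd (zz_nil X) i0) (zz_fwd (zz_nil X) i1).
  apply: zz_trans (zz_sym (zz_fwd_bwd _ ws)) _.
  apply: zz_trans (zz_fwd_bwd _ ws).
  apply: zz_cong_bwd.
  apply: zz_trans (zz_fwd_comp _ _ _) _; apply: zz_trans (zz_sym (zz_fwd_comp _ _ _)).
  by rewrite s0 s1; exact: zz_refl.
apply/zz_classP.
apply: zz_trans (zz_sym (zz_fwd_comp _ _ _)) _.
by apply: zz_trans (zz_fwd_comp _ _ _); exact: zz_cong_fwd.
Qed.

Lemma fibrant_of_fib X T (p : hom X T) : is_terminal T -> fib p -> fibrant X.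
Proof.
move=> hT fp T' hT' f; apply: rlp_fib => A B i ci wi u v e.
have [b _] := hT B; have [a [_ ha]] := hT A.
have [|w [wi' _]] := acyclic_cof_lift_fib ci wi fp (f:=u) (g:=b).
  by rewrite -(ha (p ∘ u)) // -(ha (b ∘ i)).
exists w; split=> //.
by have [c [_ hc]] := hT' B; rewrite -(hc v) // -(hc (f ∘ w)).
Qed.

Record fibrant_replacement Y := FibrantReplacement {
  fr_ob : E;
  fr_map : hom Y fr_ob;
  fr_cof : cof fr_map;
  fr_weq : weq fr_map;
  fr_fibrant : fibrant fr_ob
}.

Lemma fibrant_replacement_exists Y : inhabited (fibrant_replacement Y).
Proof.
have [T hT] := terminal_exists (@mc_lim E); have [t _] := hT Y.
have [Z [i [p [_ ci wi fp]]]] := factor_acyclic_cof_fib t.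
by split; exact: FibrantReplacement ci wi (fibrant_of_fib hT fp).
Qed.

Definition replacement Y : fibrant_replacement Y :=
  proj1_sig (constructive_indefinite_description (fun _ => True)
    (let: inhabits r := fibrant_replacement_exists Y in ex_intro _ r I)).

Definition repl Y : E := fr_ob (replacement Y).
Lemma repl_fibrant Y : fibrant (repl Y).
Proof. exact: fr_fibrant. Qed.
Arguments repl_fibrant : clear implicits.

Definition to_repl Y : hom Y (repl Y) := fr_map (replacement Y).

Lemma repl_map_exists Y Z (f : hom Y Z) :
  exists g : hom (repl Y) (repl Z), g ∘ to_repl Y = to_repl Z ∘ f.
Proof.
by apply: fibrant_extend; [exact: fr_fibrant | exact: fr_cof | exact: fr_weq].
Qed.

(** The choice is functorial only up to homotopy, by [repl_homotopic]. *)
Definition repl_map Y Z (f : hom Y Z) : hom (repl Y) (repl Z) :=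
  proj1_sig (constructive_indefinite_description _ (repl_map_exists f)).

Lemma repl_mapE Y Z (f : hom Y Z) : repl_map f ∘ to_repl Y = to_repl Z ∘ f.
Proof.
exact: proj2_sig (constructive_indefinite_description _ (repl_map_exists f)).
Qed.

Lemma repl_map_weq Y Z (f : hom Y Z) : weq f -> weq (repl_map f).
Proof.
move=> wf; apply: (weq_cancelr (f:=to_repl Y)); first exact: fr_weq.
rewrite repl_mapE; apply: weq_comp => //.
exact: fr_weq.
Qed.

(** * Zigzags acting on homotopy classes of maps from a cofibrant object *)

Section Cofibrant.
Variable X : E.
Hypothesis X_cof : cofibrant X.

(** With [w = p ∘ j], lift [u] through the acyclic fibration [p] and apply a retraction [r] of [j];
    here [j ∘ r] is homotopic to the identity, both agreeing after composition with [j]. *)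
Lemma weq_homotopy_surj Y Z (w : hom Y Z) (u : hom X Z) :
  fibrant Y -> fibrant Z -> weq w -> exists v : hom X Y, left_homotopic (w ∘ v) u.
Proof.
move=> fY fZ ww; have [W [j [p [e cj wj fp]]]] := factor_acyclic_cof_fib w.
have wp : weq p by apply: (weq_cancelr wj); rewrite e.
have [u' pu'] := cofibrant_lift u X_cof fp wp.
have [r rj] := fibrant_extend (idm Y) fY cj wj.
exists (r ∘ u'); rewrite -pu' -e -compA; apply: left_homotopic_comp.
have fW : fibrant W.
  move=> T hT f; have [z _] := hT Z.
  have -> : f = z ∘ p.
    by have [c [_ hc]] := hT W; rewrite -(hc f) // -(hc (z ∘ p)).
  by apply: fib_comp => //; exact: fZ.
apply: right_left_homotopic => //.
have h : right_homotopic (j ∘ r) (idm W).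
  by apply: (acyclic_cof_right_homotopic cj wj); rewrite -compA rj compm1 comp1m.
by have := right_homotopic_precomp u' h; rewrite comp1m -compA.
Qed.

(** With [w = p ∘ j], the homotopy lifts through the acyclic fibration [p] with ends [j ∘ u] and
    [j ∘ v], and a retraction of [j] brings it back to [Y]. *)
Lemma weq_homotopy_inj Y Z (w : hom Y Z) (u v : hom X Y) :
  fibrant Y -> weq w -> left_homotopic (w ∘ u) (w ∘ v) -> left_homotopic u v.
Proof.
move=> fY ww; have [W [j [p [e cj wj fp]]]] := factor_acyclic_cof_fib w.
have wp : weq p by apply: (weq_cancelr wj); rewrite e.
move=> /left_homotopic_good [C [i0 [i1 [s [H [gc H0 H1]]]]]].
have [||K [K0 K1 _]] := gc_lift gc (u0:=j ∘ u) (u1:=j ∘ v) (v:=H) fp wp;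
  rewrite ?compA ?e //.
have [r rj] := fibrant_extend (idm Y) fY cj wj.
rewrite -(comp1m u) -(comp1m v) -rj -!compA; apply: left_homotopic_comp.
exists C, i0, i1, s, K; split=> //.
- exact: gc_weq gc.
- exact: gc_s0 gc.
- exact: gc_s1 gc.
Qed.

Definition repl_lift Y Z (w : hom Y Z) (ww : weq w) (u : hom X (repl Z)) :
    hom X (repl Y) :=
  proj1_sig (constructive_indefinite_description _
    (weq_homotopy_surj u (repl_fibrant _) (repl_fibrant _) (repl_map_weq ww))).

Lemma repl_liftP Y Z (w : hom Y Z) (ww : weq w) (u : hom X (repl Z)) :
  left_homotopic (repl_map w ∘ repl_lift ww u) u.
Proof.
exact: proj2_sig (constructive_indefinite_description _
  (weq_homotopy_surj u (repl_fibrant _) (repl_fibrant _) (repl_map_weq ww))).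
Qed.

(** The action of a zigzag on homotopy classes of maps from [X] to fibrant
    replacements, evaluated at the class of [X -> RX]. *)
Fixpoint zz_act Y (p : zigzag X Y) : hom X (repl Y) :=
  match p with
  | zz_nil => to_repl X
  | zz_fwd _ _ p' f => repl_map f ∘ zz_act p'
  | zz_bwd _ _ _ hw p' => repl_lift hw (zz_act p')
  end.

Lemma repl_homotopic Y Z (f g : hom (repl Y) Z) (u : hom X (repl Y)) :
  fibrant Z -> f ∘ to_repl Y = g ∘ to_repl Y -> left_homotopic (f ∘ u) (g ∘ u).
Proof.
move=> fZ e; apply: right_left_homotopic => //; apply: right_homotopic_precomp.
exact: acyclic_cof_right_homotopic (fr_cof _) (fr_weq _) e.
Qed.

(** Induction over the generators of the congruence: backward steps use that weak equivalences are
    injective on homotopy classes, and the category laws use [repl_homotopic]. *)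
Lemma zz_act_eq Y (p q : zigzag X Y) :
  zz_eq p q -> left_homotopic (zz_act p) (zz_act q).
Proof.
elim=> {Y p q} /=.
- by move=> *; exact: left_homotopic_refl.
- by move=> *; exact: left_homotopic_sym.
- by move=> Y p q r _ h1 _ h2; exact: left_homotopic_trans h1 h2.
- by move=> *; exact: left_homotopic_comp.
- move=> Y Z p q w hw _ h.
  apply: (weq_homotopy_inj (repl_fibrant _) (repl_map_weq hw)).
  apply: (left_homotopic_trans X_cof (repl_liftP _ _)).
  apply: (left_homotopic_trans X_cof h).
  exact: left_homotopic_sym (repl_liftP _ _).
- move=> Y p; rewrite -[X in left_homotopic _ X]comp1m.
  apply: repl_homotopic; first exact: fr_fibrant.
  by rewrite repl_mapE comp1m compm1.
- move=> Y Z W p f g; rewrite compA.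
  apply: repl_homotopic; first exact: fr_fibrant.
  by rewrite -compA !repl_mapE !compA repl_mapE.
- by move=> *; exact: repl_liftP.
- move=> Y Z p w hw.
  apply: (weq_homotopy_inj (repl_fibrant _) (repl_map_weq hw)).
  exact: repl_liftP.
Qed.

(** The zigzag made of [f] alone acts as [to_repl Y ∘ f]; for fibrant [Y] the map [to_repl Y] has a
    retraction. *)
Lemma gamma_eq_left_homotopic Y (f g : hom X Y) :
  fibrant Y -> gamma_map f = gamma_map g -> left_homotopic f g.
Proof.
move=> fY /zz_classP /zz_act_eq /=; rewrite !repl_mapE => h.
have [r rj] := fibrant_extend (idm Y) fY (fr_cof (replacement Y)) (fr_weq (replacement Y)).
by have := left_homotopic_comp r h; rewrite !compA rj !comp1m.
Qed.

End Cofibrant.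
End Localization.

(** * The separation grid and strict extensions *)

Definition isomorphism (C : category) (X Y : C) (f : hom X Y) : Prop :=
  exists g : hom Y X, g ∘ f = idm X /\ f ∘ g = idm Y.

Lemma isomorphism_id (C : category) (X : C) : isomorphism (idm X).
Proof. by exists (idm X); rewrite comp1m. Qed.

Lemma isomorphism_prod_map (C : category) (I : Type) (X Y : I -> C)
    (p : product X) (q : product Y) (f : forall i, hom (X i) (Y i)) :
  (forall i, isomorphism (f i)) -> isomorphism (prod_map p q f).
Proof.
move=> h.
pose g i := proj1_sig (constructive_indefinite_description _ (h i)).
have hg i : g i ∘ f i = idm (X i) /\ f i ∘ g i = idm (Y i).
  exact: proj2_sig (constructive_indefinite_description _ (h i)).
exists (prod_map q p g); split; apply: prod_ext => i;
  rewrite compA proj_tuple -compA proj_tuple compA.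
- by rewrite (proj1 (hg i)) comp1m compm1.
- by rewrite (proj2 (hg i)) comp1m compm1.
Qed.

(** Positions up to [n] come from [s], so [n.+1] is the first copy of [M]. *)
Lemma splice_leg_last (C : category) (n : nat) (s : nat -> C) (M X : C)
    (c : forall l, hom X (s l)) (e : hom X M) :
  isomorphism e -> isomorphism (splice_leg n c e n.+1).
Proof.
move=> he; elim: n s c => [|n IH] s c; first exact: he.
exact: (IH (fun i => s i.+1) (fun i => c i.+1)).
Qed.

(** * Identifications and fibrations in the grid *)

Section Grid.
Variables (E : model_category) (J : weak_lattice) (Yt : functor J (ho E)).
Variables (x : J) (k : nat) (Y : lift Yt (boundary x k)).
Variables (lc : limit_choices Y) (fc : factor_choices E J).

(** The index [m.-2.+1] is m-1, where the tower first reaches M^v_{m-1}: right above the base for m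
    = 2, at the splice point for m > 2. So row m-1 of column 0 is a copy of L^y_m. *)
Lemma reduced_leg_isomorphism (m : nat) (v : J) :
  2 <= m -> isomorphism (rd_leg (reduced_at lc fc m v) m.-2.+1).
Proof.
case: m => [|[|[|m]]] // _; first exact: isomorphism_id.
exact: splice_leg_last (isomorphism_id _).
Qed.

Lemma Lto0_isomorphism (m : nat) (y : J) :
  2 <= m -> isomorphism (Lto0 (reduced_at lc fc m) y m.-2.+1).
Proof.
move=> m2; apply: isomorphism_prod_map => a.
exact: reduced_leg_isomorphism.
Qed.

Lemma forget_mono (y : J) (m : nat) (Z : E) (u v : hom Z (Mob lc y m)) :
  forget lc y m ∘ u = forget lc y m ∘ v -> u = v.
Proof.
move=> e; apply: mt_ext => a.
by rewrite -(proj_tuple (Bob lc y m) (mt_proj (Mob lc y m)) a) -!compA e.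
Qed.

(** A product of the monomorphisms [forget]. The total operation fixes a composite to D only, and
    this recovers the composite to L. *)
Lemma LtoD_mono (y : J) (m : nat) (Z : E) (u v : hom Z (Lob lc y m)) :
  LtoD lc y m ∘ u = LtoD lc y m ∘ v -> u = v.
Proof.
move=> e; apply: prod_ext => a; apply: forget_mono.
rewrite !compA -(proj_tuple (Dob lc y m)
  (fun a => forget lc (tgt a) m ∘ proj (Lob lc y m) a) a) -!compA.
by congr (_ ∘ _).
Qed.

Lemma descend_Lto0 (m : nat) (y : J) (l : nat) :
  descend (Fcol lc fc y m 0) l ∘ Lto0 (reduced_at lc fc m) y l = LtoD lc y m.
Proof.
elim: l => [|l IH] /=; first by rewrite comp1m Lto0_0.
by rewrite -compA Lto0_down.
Qed.

Lemma dg_q_rlp (m : nat) (y : J) (j : nat) : rlp (dg_q (Fdiag lc fc y m j)).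
Proof. by apply: fib_rlp; case: j => [|j]; exact: acf_fib_fib. Qed.

Lemma AtoL_rlp (m : nat) (y : J) : reedy_fibrant Y -> rlp (AtoL lc y m).
Proof.
move=> reedy; apply: rlp_prod_map => a; apply: fib_rlp.
(* Reedy fibrancy speaks of the matching object at [deg t]; the target has degree exactly [m], so
   [Mob] is generalized to rewrite [m] in its type. *)
case: a => t f p /= /eqP dt; move: (Mob lc t m); rewrite -dt => M.
exact: reedy.
Qed.

Lemma Ptop_from (m : nat) (y : J) (j l : nat) :
  top_map (Fcol lc fc y m j) l ∘ Ptop fc (reduced_at lc fc m) y j
  = from (Fcol lc fc y m j) l ∘ pb1 (Pob lc y m).
Proof. exact: proj2_sig (Ptop_data fc (reduced_at lc fc m) y j) l. Qed.

End Grid.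

(** * Strict extensions as sections over L *)

Section Lifting.
Variables (E : model_category) (J : weak_lattice) (Yt : functor J (ho E)).
Variables (x : J) (k : nat) (k_lt_x : k < deg x) (k_ge2 : 2 <= k).
Variables (Y : lift Yt (boundary x k)) (lc : limit_choices Y).
Variables (Y' : lift Yt (under x k.-1)) (YY' : agree Y Y').

Lemma weak_lattice_endo (s : J) (f : hom s s) : f = idm s.
Proof.
case: (wl_decreasing f) => [h|]; last by rewrite ltnn.
(* Case analysis on [is_identity] needs two independent end points; the transport along [s = t] then
   disappears by proof irrelevance. *)
have : forall (s t : J) (f : hom s t), is_identity f ->
    forall e : s = t, f = eq_rect s (fun t => hom s t) (idm s) t e.
  by move=> ? ? ? [] r e; rewrite (proof_irrelevance _ e erefl).
by move=> /(_ _ _ _ h erefl).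
Qed.

Lemma weak_lattice_deg (s t : J) (f : hom s t) : s <> t -> deg t < deg s.
Proof. by move=> ne; case: (wl_decreasing f) => // h; case: ne; case: h. Qed.

Lemma boundary_of_under t : under x k t -> ~ under x k.-1 t -> boundary x k t.
Proof. by move=> ut nu; split=> // e; apply: nu; rewrite e; exact: under_self. Qed.

Lemma level_of_under t : under x k t -> ~ under x k.-1 t -> level k (deg t).
Proof.
move=> [ht [e|le]] nu; first by case: nu; split; [|left].
rewrite /level eqn_leq le leqNgt; apply/negP => lt; case: nu; split=> //; right.
exact: below_pred.
Qed.

(** A map from [s] to [x] would force |x| < |s| <= k < |x|. *)
Lemma boundary_target s t : boundary x k s -> under x k t -> hom s t -> boundary x k t.
Proof.
move=> [[hs [|les]] ne] ut f //; split=> // e; move: f; rewrite e => f.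
have := weak_lattice_deg f ne.
by rewrite ltnNge (leq_trans les (ltnW k_lt_x)).
Qed.

Lemma boundary_pred t : boundary x k t -> deg t < k -> under x k.-1 t.
Proof. by move=> [[ht _] _] lt; split=> //; right; exact: below_pred. Qed.

Lemma boundary_level t : boundary x k t -> level k (deg t) -> ~ under x k.-1 t.
Proof.
move=> [_ ne] /eqP e [_ [//|]]; rewrite e.
by case: k k_ge2 => // m _; rewrite ltnn.
Qed.

Section Extension.
Variable s_k : hom (obj Yt x) (Aob lc x k).
Hypothesis s_kP : forall g : arrow x k x (level k),
  gamma_map (proj (Aob lc x k) g ∘ s_k) = fmap Yt (arr g).
Hypothesis s_kL : AtoL lc x k ∘ s_k = sigma_L lc YY'.

Definition extension_x (t : J) (q : under x k t) (f : hom x t) :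
    hom (obj Yt x) (obj Yt t) :=
  match excluded_middle_informative (under x k.-1 t) with
  | left u => lmap Y' (under_self x k.-1) u f
  | right n => proj (Aob lc x k)
      (Arrow f (boundary_of_under q n) (level_of_under q n)) ∘ s_k
  end.

Definition extension (s t : J) (p : under x k s) (q : under x k t) (f : hom s t) :
    hom (obj Yt s) (obj Yt t) :=
  match excluded_middle_informative (s = x) with
  | left e => eq_rect_r (fun s => hom s t -> hom (obj Yt s) (obj Yt t))
                (@extension_x t q) e f
  | right n => lmap Y (conj p n) (boundary_target (conj p n) q f) f
  end.

Lemma extension_xE t p q f : @extension x t p q f = extension_x q f.
Proof.
rewrite /extension; case: excluded_middle_informative => // e.
by rewrite (proof_irrelevance _ e erefl).
Qed.

Lemma extension_boundary s t p q f (bs : boundary x k s) (bt : boundary x k t) :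
  @extension s t p q f = lmap Y bs bt f.
Proof.
rewrite /extension; case: excluded_middle_informative => [e|n].
  by case: (proj2 bs).
by rewrite (proof_irrelevance _ (conj p n) bs)
  (proof_irrelevance _ (boundary_target _ _ _) bt).
Qed.

Lemma extension_x_low t q f (u : under x k.-1 t) :
  @extension_x t q f = lmap Y' (under_self x k.-1) u f.
Proof.
rewrite /extension_x; case: excluded_middle_informative => // u'.
by rewrite (proof_irrelevance _ u' u).
Qed.

Lemma extension_x_level t q f (bt : boundary x k t) (lt : level k (deg t)) :
  @extension_x t q f = proj (Aob lc x k) (Arrow f bt lt) ∘ s_k.
Proof.
rewrite /extension_x; case: excluded_middle_informative => [u|n].
  by case: (boundary_level bt lt).
by rewrite (proof_irrelevance _ (boundary_of_under q n) bt)
  (proof_irrelevance _ (level_of_under q n) lt).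
Qed.

Lemma extension_id s (p q : under x k s) : extension p q (idm s) = idm (obj Yt s).
Proof.
case: (excluded_middle_informative (s = x)) => [e|n].
  subst s; rewrite extension_xE (extension_x_low _ _ (under_self x k.-1)).
  exact: lmap_id.
by rewrite (extension_boundary _ _ _ (conj p n) (conj p n)) lmap_id.
Qed.

Lemma extension_lifts s t (p : under x k s) (q : under x k t) (f : hom s t) :
  gamma_map (extension p q f) = fmap Yt f.
Proof.
case: (excluded_middle_informative (s = x)) => [e|n].
  subst s; rewrite extension_xE /extension_x.
  case: excluded_middle_informative => u; first exact: lmap_lifts.
  exact: (s_kP (Arrow f _ _)).
rewrite (extension_boundary _ _ _ (conj p n) (boundary_target (conj p n) q f)).
exact: lmap_lifts.
Qed.

(** Maps starting in the boundary are handled by [Y], and a middle object of degree below k by [Y']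
    and [YY']. The remaining case is x -> s -> t with |s| = k and t different from s, where
    functoriality is one component of [s_kL]. *)
Lemma extension_comp r s t (p : under x k r) (q : under x k s) (u : under x k t)
    (g : hom s t) (f : hom r s) :
  extension p u (g ∘ f) = extension q u g ∘ extension p q f.
Proof.
case: (excluded_middle_informative (r = x)) => [e|n]; last first.
  have bs := boundary_target (conj p n) q f.
  have bt := boundary_target bs u g.
  rewrite (extension_boundary _ _ _ (conj p n) bt) (extension_boundary _ _ _ bs bt).
  by rewrite (extension_boundary _ _ _ (conj p n) bs) (lmap_comp _ _ bs).
subst r.
case: (excluded_middle_informative (s = x)) => [e|n].
  subst s; rewrite (weak_lattice_endo f) compm1.
  rewrite (proof_irrelevance _ q p) (_ : extension p p (idm x) = idm _); last first.
    exact: extension_id.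
  by rewrite compm1.
have bs : boundary x k s := conj q n.
have bt := boundary_target bs u g.
rewrite !extension_xE (extension_boundary _ _ _ bs bt).
case: (excluded_middle_informative (under x k.-1 s)) => [us|ns].
  have ut : under x k.-1 t.
    case: (us) => _ [//|les]; split; first by case: u.
    right; case: (excluded_middle_informative (s = t)) => [<-//|ne].
    exact: leq_trans (ltnW (weak_lattice_deg g ne)) les.
  rewrite (extension_x_low _ _ us) (extension_x_low _ _ ut).
  by rewrite (YY' bs bt us ut) -lmap_comp.
have ls := level_of_under q ns.
rewrite (extension_x_level _ _ bs ls).
case: (excluded_middle_informative (s = t)) => [e|ne].
  subst t; rewrite (weak_lattice_endo g) comp1m (extension_x_level _ _ bs ls).
  by rewrite (proof_irrelevance _ bt bs) lmap_id comp1m.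
have lt : below k (deg t).
  by rewrite /below -(eqP ls); exact: weak_lattice_deg g ne.
rewrite (extension_x_low _ _ (boundary_pred bt lt)).
pose a := Arrow f bs ls; pose b := @Arrow J x k s (below k) t g bt lt.
have := congr1 (fun w => proj (Lob lc x k) a ∘ w) s_kL.
rewrite compA !proj_tuple -compA => h.
transitivity (mt_proj (Mob lc s k) b
    ∘ (matching_map (Mob lc s k) bs ∘ (proj (Aob lc x k) a ∘ s_k))); last first.
  by rewrite compA mt_proj_tuple.
rewrite h mt_proj_tuple.
rewrite /Y'_map /=; congr (lmap Y' _ _ _); exact: proof_irrelevance.
Qed.

Definition extension_lift : lift Yt (under x k) :=
  Lift extension_id extension_comp extension_lifts.

Lemma extension_agree : agree Y extension_lift /\ agree Y' extension_lift.
Proof.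
split=> s t p q p' q' f /=; first by rewrite (extension_boundary _ _ _ p q).
case: (excluded_middle_informative (s = x)) => [e|n].
  subst s; rewrite extension_xE (extension_x_low _ _ q).
  by rewrite (proof_irrelevance _ p (under_self x k.-1)).
rewrite (extension_boundary _ _ _ (conj p' n) (boundary_target (conj p' n) q' f)).
by symmetry; exact: YY'.
Qed.

End Extension.

Lemma under_level (g : arrow x k x (level k)) : under x k (tgt g).
Proof. by case: (arr_in g). Qed.

Lemma extension_iff_section :
  (exists Z : lift Yt (under x k), agree Y Z /\ agree Y' Z) <->
  (exists s : hom (obj Yt x) (Aob lc x k),
     (forall g, gamma_map (proj (Aob lc x k) g ∘ s) = fmap Yt (arr g)) /\
     AtoL lc x k ∘ s = sigma_L lc YY').
Proof.
split=> [[Z [YZ Y'Z]]|[s [sP sL]]]; last first.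
  by exists (extension_lift sP sL); exact: extension_agree.
(* The degree-k values of [Z] on maps out of x; lying over [sigma_L] is functoriality of [Z] on
   composites through degree k. *)
exists (tuple (Aob lc x k) (fun g => lmap Z (under_self x k) (under_level g) (arr g))).
split=> [g|]; first by rewrite proj_tuple lmap_lifts.
apply: prod_ext => a; rewrite compA !proj_tuple -compA proj_tuple.
apply: mt_ext => b; rewrite compA !mt_proj_tuple.
have ub : under x k (tgt b) by case: (arr_in b).
rewrite (YZ _ _ _ _ (under_level a) ub) -lmap_comp /Y'_map /=.
by symmetry; exact: Y'Z.
Qed.

End Lifting.

(** * The obstructions *)

Section Operations.
Variables (E : model_category) (J : weak_lattice) (Yt : functor J (ho E)).
Hypothesis Yt_bifibrant : forall s : J, fibrant (obj Yt s) /\ cofibrant (obj Yt s).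
Variables (x : J) (k : nat) (k_lt_x : k < deg x) (k_ge2 : 2 <= k).
Variables (Y : lift Yt (boundary x k)) (Y_reedy : reedy_fibrant Y).
Variables (Y' : lift Yt (under x k.-1)) (YY' : agree Y Y').
Variables (lc : limit_choices Y) (fc : factor_choices E J).
Variable sigma_k : hom (obj Yt x) (Aob lc x k).
Hypothesis sigma_kP : forall g : arrow x k x (level k),
  gamma_map (proj (Aob lc x k) g ∘ sigma_k) = fmap Yt (arr g).

Local Notation Yx := (obj Yt x).
Local Notation Fc := (Fcol lc fc x k).
Local Notation Fd := (Fdiag lc fc x k).
Local Notation T := (reduced_at lc fc k).
Local Notation eta := (eta lc YY').
Local Notation sigma_L := (sigma_L lc YY').

Let Yx_cof : cofibrant Yx := proj2 (Yt_bifibrant x).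

(** As the factors of A are fibrant and Y(x) is cofibrant, equality in [ho E] is homotopy in each
    factor, and the homotopies assemble over the product. *)
Lemma section_iff_homotopy :
  (exists s : hom Yx (Aob lc x k),
     (forall g, gamma_map (proj (Aob lc x k) g ∘ s) = fmap Yt (arr g)) /\
     AtoL lc x k ∘ s = sigma_L) <->
  (exists s : hom Yx (Aob lc x k),
     left_homotopic sigma_k s /\ AtoL lc x k ∘ s = sigma_L).
Proof.
split=> -[s [h sL]]; exists s; split=> //.
- apply: left_homotopic_product => // g; first by case: (Yt_bifibrant (tgt g)).
  apply: gamma_eq_left_homotopic => //; first by case: (Yt_bifibrant (tgt g)).
  by rewrite sigma_kP h.
- move=> g; rewrite -sigma_kP; apply: gamma_left_homotopic; apply: left_homotopic_sym.
  exact: left_homotopic_comp.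
Qed.

Lemma section_of_homotopy : left_homotopic (AtoL lc x k ∘ sigma_k) sigma_L ->
  exists s : hom Yx (Aob lc x k),
    left_homotopic sigma_k s /\ AtoL lc x k ∘ s = sigma_L.
Proof.
move=> /(homotopy_lifting Yx_cof (AtoL_rlp Y_reedy (lc:=lc) (m:=k) (y:=x))) [s [sL hs]].
by exists s.
Qed.

Lemma QtoL_eta : QtoL lc x k ∘ eta = sigma_L.
Proof. exact: pb2_pair. Qed.

Lemma QtoB_eta : QtoB lc x k ∘ eta = sigma_lt lc Y'.
Proof. exact: pb1_pair. Qed.

Lemma from0_eta l : from (Fc 0) l ∘ eta = Lto0 T x l ∘ sigma_L.
Proof. by rewrite -QtoL_eta compA. Qed.

Lemma homotopy_of_row :
  left_homotopic (Lto0 T x k.-2.+1 ∘ (AtoL lc x k ∘ sigma_k))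
    (Lto0 T x k.-2.+1 ∘ sigma_L) ->
  left_homotopic (AtoL lc x k ∘ sigma_k) sigma_L.
Proof.
have [r [rL _]] := Lto0_isomorphism lc fc x k_ge2.
by move=> /(left_homotopic_comp r); rewrite !(compA r) rL !comp1m.
Qed.

Lemma section_of_total : total_vanishes fc YY' sigma_k ->
  exists s : hom Yx (Aob lc x k),
    left_homotopic sigma_k s /\ AtoL lc x k ∘ s = sigma_L.
Proof.
move=> [theta [[_ hD] /(homotopy_class_eq Yx_cof) [h _]]].
apply: section_of_homotopy; apply: homotopy_of_row.
(* The operation prescribes only the composite of [theta] to D. Since F^{0,k} is a copy of L and L
   -> D is a monomorphism, the composite to F^{0,k} is determined as well. *)
have hrow : pb2 (F1k lc fc) ∘ theta
    = Lto0 T x k.-2.+1 ∘ (AtoL lc x k ∘ sigma_k).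
  have [r [rL Lr]] := Lto0_isomorphism lc fc x k_ge2.
  have e : r ∘ (pb2 (F1k lc fc) ∘ theta) = AtoL lc x k ∘ sigma_k.
    apply: LtoD_mono; rewrite [RHS]compA -hD -{1}(descend_Lto0 lc fc k x k.-2.+1).
    by rewrite -compA (compA _ r) Lr comp1m !compA pb_square.
  by rewrite -e !compA Lr comp1m.
have := left_homotopic_comp (pb2 (F1k lc fc)) h; rewrite hrow => h'.
apply: left_homotopic_sym; rewrite -from0_eta.
suff <- : pb2 (F1k lc fc) ∘ (Gamma lc fc ∘ eta)
    = from (Fc 0) k.-2.+1 ∘ eta by [].
by rewrite compA; congr (_ ∘ _); exact: pb2_pair.
Qed.

Lemma total_of_section (s : hom Yx (Aob lc x k)) :
  left_homotopic sigma_k s -> AtoL lc x k ∘ s = sigma_L ->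
  total_vanishes fc YY' sigma_k.
Proof.
move=> h sL.
have GE : pb2 (F1k lc fc) ∘ (Gamma lc fc ∘ eta)
    = Lto0 T x k.-2.+1 ∘ sigma_L.
  by rewrite -from0_eta compA; congr (_ ∘ _); exact: pb2_pair.
(* In F^{0,k} the map [Gamma ∘ eta] becomes the image of [s], which is homotopic to that of
   [sigma_k]. The lifted homotopy ends at a [theta] lying strictly over the latter. *)
have [||theta [pt ht]] := @homotopy_lifting E Yx Yx_cof _ _ (pb2 (F1k lc fc))
    (Gamma lc fc ∘ eta) (Lto0 T x k.-2.+1 ∘ (AtoL lc x k ∘ sigma_k)).
- exact: rlp_pullback (dg_q_rlp (lc:=lc) (fc:=fc) (m:=k) (y:=x) (j:=0)).
- rewrite GE -sL; apply: left_homotopic_sym; apply: left_homotopic_comp.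
  exact: left_homotopic_comp.
exists theta; split; last first.
  by apply/(homotopy_class_eq Yx_cof)/(left_homotopicP Yx_cof).
split.
- apply/(left_homotopicP Yx_cof)/left_homotopic_sym.
  have := left_homotopic_comp (F1k_to_F11 lc fc) ht.
  suff -> : F1k_to_F11 lc fc ∘ (Gamma lc fc ∘ eta)
      = iota lc fc k x ∘ sigma_lt lc Y' by [].
  rewrite -QtoB_eta !compA; congr (_ ∘ _); exact: pb1_pair.
- rewrite compA /F1k_to_F11 pb_square -compA pt (compA (descend _ _)).
  by rewrite descend_Lto0; exact: compA.
Qed.

(** [d] is the composite of horizontal maps F^{j,n+1} -> F^{0,n+1}; the equation [n = j + l] avoids
    casts between row types. *)
Lemma sep_chain_row (j : nat) (kappa : hom Yx (top (Fc j))) :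
  sep_chain YY' sigma_k kappa -> forall l n, n = j + l ->
  exists d : hom (row (Fc j) l) (row (Fc 0) n),
    d ∘ from (Fc j) l = from (Fc 0) n /\
    d ∘ (top_map (Fc j) l ∘ kappa) = top_map (Fc 0) n ∘ sigma_k.
Proof.
elim=> {j kappa} [|j kappa theta kappa' _ IH _ _ [hu _]] l n e.
  by subst n; exists (idm _); rewrite !comp1m.
have [|d [df dt]] := IH l.+1 n; first by rewrite e addnS addSn.
pose p := next_col_row fc T x j l.
exists (d ∘ pb2 p); split.
- rewrite -df -compA; congr (_ ∘ _); exact: pb2_pair.
- rewrite -dt -hu -compA; congr (_ ∘ _); rewrite !compA; congr (_ ∘ _).
  exact: pb2_pair.
Qed.

Lemma sep_chain_homotopic (j : nat) (kappa : hom Yx (top (Fc j))) :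
  sep_chain YY' sigma_k kappa -> 0 < j ->
  left_homotopic (top_map (Fc j) 0 ∘ kappa) (from (Fc j) 0 ∘ eta).
Proof.
by case=> // {}j {}kappa theta kappa' _ _ [hv _] [_ e] _; rewrite -e in hv.
Qed.

Lemma section_of_sequence : sequence_vanishes fc YY' sigma_k ->
  exists s : hom Yx (Aob lc x k),
    left_homotopic sigma_k s /\ AtoL lc x k ∘ s = sigma_L.
Proof.
move=> [kappa hk]; apply: section_of_homotopy; apply: homotopy_of_row.
(* Row 0 of column k-1 is F^{k-1,k}, which lies over row k-1 of column 0, that is F^{0,k}. *)
have [|d [df dt]] := sep_chain_row hk (l:=0) (n:=k.-2.+1).
  by rewrite addn0; case: k k_ge2 => [|[]].
have := left_homotopic_comp d (sep_chain_homotopic hk _).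
rewrite dt compA df from0_eta /= compA; apply.
by case: k k_ge2 => [|[]].
Qed.

Lemma umap_rlp j : rlp (umap lc fc j).
Proof. exact: rlp_pullback (dg_q_rlp (lc:=lc) (fc:=fc) (m:=k) (y:=x) (j:=j)). Qed.

Lemma sequence_of_section (s : hom Yx (Aob lc x k)) :
  left_homotopic sigma_k s -> AtoL lc x k ∘ s = sigma_L ->
  sequence_vanishes fc YY' sigma_k.
Proof.
move=> h sL.
have rho_eq : QtoL lc x k ∘ eta = AtoL lc x k ∘ s by rewrite QtoL_eta.
pose rho : hom Yx (Pob lc x k) := pb_pair (Pob lc x k) rho_eq.
(* The invariant of the induction over columns: [kappa] is homotopic to the map that [rho] induces
   through P. *)
suff ex j : exists kappa : hom Yx (top (Fc j)),
    sep_chain YY' sigma_k kappa /\ left_homotopic (Ptop fc T x j ∘ rho) kappa.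
  by have [kappa [hk _]] := ex k.-1; exists kappa.
elim: j => [|j [kappa [hk hr]]].
  exists sigma_k; split; first exact: SepChain0.
  apply: left_homotopic_sym; suff -> : Ptop fc T x 0 ∘ rho = s by [].
  exact: pb2_pair.
have [|kappa' [uk hr']] := @homotopy_lifting E Yx Yx_cof _ _ (umap lc fc j)
    (Ptop fc T x j.+1 ∘ rho) kappa (@umap_rlp j).
  by rewrite compA (top_next_P fc T x j).
exists kappa'; split=> //.
(* The map from P to F^{j+1,j+2} factors through Q, and [rho] followed by P -> Q is [eta]; so the
   invariant gives the vanishing. *)
have hq : left_homotopic (Phimap lc fc j ∘ kappa') (qphi lc fc j ∘ eta).
  apply: left_homotopic_sym.
  have := left_homotopic_comp (Phimap lc fc j) hr'.
  rewrite compA (Ptop_from lc fc k x j.+1 0) -compA.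
  by rewrite (pb1_pair (Pob lc x k)).
apply: (SepChainS hk (theta:=Phimap lc fc j ∘ kappa')) => //.
- split; last first.
    rewrite -uk !compA; congr (_ ∘ _); exact: pb2_pair.
  apply/(left_homotopicP Yx_cof).
  have := left_homotopic_comp (rmap lc fc j) hq.
  suff -> : rmap lc fc j ∘ (qphi lc fc j ∘ eta) = dg_phi (Fd j) ∘ eta by [].
  by rewrite compA; congr (_ ∘ _); exact: pb1_pair.
- exact/(left_homotopicP Yx_cof).
Qed.

(** The homotopy is lifted along the fibration q_{j+1} from phi^{j+1} eta; its end and
    [betamap ∘ kappa] form an element of the pullback F^{j+1,j+2}. *)
Lemma sep_operation_exists (j : nat) (kappa : hom Yx (top (Fc j))) :
  left_homotopic (top_map (Fc j) 0 ∘ kappa) (from (Fc j) 0 ∘ eta) ->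
  exists c, sep_operation YY' kappa c.
Proof.
rewrite -(dg_eq (Fd j)) -compA => /left_homotopic_sym.
move=> /(homotopy_lifting Yx_cof (dg_q_rlp (lc:=lc) (fc:=fc) (m:=k) (y:=x) (j:=j))) [phi [qphi h]].
have e : dg_q (Fd j) ∘ phi = descend (Fc j) 1 ∘ (betamap lc fc j ∘ kappa).
  by rewrite qphi compA /betamap descend_top.
exists (homotopy_class (pb_pair (Fstep lc fc j) e)).
exists (pb_pair (Fstep lc fc j) e); split=> //; split; last exact: pb2_pair.
by apply/(left_homotopicP Yx_cof)/left_homotopic_sym; rewrite /rmap pb1_pair.
Qed.

(** D is an iterated product of fibrant values of [Y], so the claim can be tested factor by factor
    in [ho E], where both sides are the value of [Yt] on a composite. *)
Lemma first_operation_homotopy :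
  left_homotopic (top_map (Fc 0) 0 ∘ sigma_k) (from (Fc 0) 0 ∘ eta).
Proof.
have -> : top_map (Fc 0) 0 = LtoD lc x k ∘ AtoL lc x k.
  by rewrite /= Lto0_0.
rewrite from0_eta Lto0_0.
have fib_obj t : fibrant (obj Yt t) by case: (Yt_bifibrant t).
apply: (left_homotopic_product (p:=Dob lc x k)) => // [a|a].
  exact: fibrant_product.
apply: left_homotopic_product => // b; apply: gamma_eq_left_homotopic => //.
have LtoDE (f : hom Yx (Lob lc x k)) : proj (Bob lc (tgt a) k) b
    ∘ (proj (Dob lc x k) a ∘ (LtoD lc x k ∘ f))
    = mt_proj (Mob lc (tgt a) k) b ∘ (proj (Lob lc x k) a ∘ f).
  by rewrite (compA _ (LtoD lc x k)) proj_tuple -compA compA proj_tuple.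
rewrite -(compA (LtoD lc x k)) !LtoDE !(proj_tuple (Lob lc x k)) mt_proj_tuple.
rewrite (compA _ (AtoL lc x k)) proj_tuple -compA compA mt_proj_tuple.
by rewrite gamma_comp sigma_kP !lmap_lifts -fmapM.
Qed.

Lemma operations_separate : separates fc YY' sigma_k.
Proof.
split; first exact: sep_operation_exists first_operation_homotopy.
move=> j kappa theta jk hk [hr hp].
have e : dg_q (Fd j) ∘ (rmap lc fc j ∘ theta) = top_map (Fc j) 0 ∘ kappa.
  by rewrite compA /rmap pb_square -compA hp compA descend_top.
(* F^{j+1,k+1} is a pullback of F^{j+1,j+1} and F^{j,k+1}, which gives existence and uniqueness of
   [kappa']. *)
pose kappa' : hom Yx (top (Fc j.+1)) := pb_pair (next_col_top fc T x j) e.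
have uk : umap lc fc j ∘ kappa' = kappa by exact: pb2_pair.
have pk : Phimap lc fc j ∘ kappa' = theta.
  apply: (pb_ext (Fstep lc fc j)).
  - rewrite compA /Phimap (pb1_pair (Fstep lc fc j)).
    exact: (pb1_pair (next_col_top fc T x j) e).
  - rewrite compA /Phimap (pb2_pair (Fstep lc fc j)) -compA -[RHS]/(pmap _ _ _ ∘ _) hp.
    by congr (_ ∘ _).
exists kappa'; split.
  split=> // kappa'' [uk' pk']; apply: (pb_ext (next_col_top fc T x j)).
  - rewrite (pb1_pair (next_col_top fc T x j)) -pk' /rmap compA.
    by congr (_ ∘ _); exact: pb1_pair.
  - by rewrite (pb2_pair (next_col_top fc T x j)) -uk'.
(* As [Phimap ∘ kappa' = theta], vanishing at [theta] is exactly the homotopy that makes the next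
   operation non-empty. *)
move=> [hv _] _; apply: sep_operation_exists.
by rewrite -pk in hv.
Qed.

End Operations.

Theorem theorem4p24
  (E : model_category) (J : weak_lattice) (Yt : functor J (ho E))
  (Yt_bifibrant : forall s : J, fibrant (obj Yt s) /\ cofibrant (obj Yt s))
  (x : J) (n k : nat) (n_lt_x : n < deg x) (k_le_n : k <= n) (k_ge2 : 2 <= k)
  (Yk : lift Yt (boundary x k)) (Yk_reedy : reedy_fibrant Yk)
  (Ykm1 : lift Yt (under x k.-1)) (Yk_Ykm1 : agree Yk Ykm1)
  (lc : limit_choices Yk) (fc : factor_choices E J)
  (sigma_k : hom (obj Yt x) (Aob lc x k))
  (sigma_kP : forall g : arrow x k x (level k),
     gamma_map (proj (Aob lc x k) g ∘ sigma_k) = fmap Yt (arr g)) :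
  separates fc Yk_Ykm1 sigma_k /\
  ((exists Z : lift Yt (under x k), agree Yk Z /\ agree Ykm1 Z) <->
     total_vanishes fc Yk_Ykm1 sigma_k) /\
  (total_vanishes fc Yk_Ykm1 sigma_k <->
     sequence_vanishes fc Yk_Ykm1 sigma_k).
Proof.
have k_lt_x : k < deg x by exact: leq_ltn_trans k_le_n n_lt_x.
(* All three conditions are compared with the existence of a map [s] over [sigma_L] homotopic to
   [sigma_k]. *)
have total : total_vanishes fc Yk_Ykm1 sigma_k <-> exists s : hom (obj Yt x) (Aob lc x k),
    left_homotopic sigma_k s /\ AtoL lc x k ∘ s = sigma_L lc Yk_Ykm1.
  split=> [|[s [h sL]]]; first exact: section_of_total.
  exact: total_of_section h sL.
split; first exact: operations_separate.
split; rewrite total.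
  rewrite (extension_iff_section k_lt_x k_ge2 lc Yk_Ykm1).
  exact: section_iff_homotopy.
split=> [[s [h sL]]|]; last exact: section_of_sequence.
exact: sequence_of_section h sL.
Qed.
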